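(* Let $q$ be a nonzero complex number with $|q|<1$. Let $t,m\in\mathbb{Z}$ with $t\geq1$. For generic $x$ (that is, $x\in\mathbb{C}\setminus\{0\}$ with $x\neq-1$ and $x$ not an odd integral power of $q$), we have $$\begin{aligned}\mathcal{V}_t^{(m)}(x;q)=\;&\frac{q^{-2t^2+3t-4tm}}{(1+x)(q)_\infty(q^2;q^2)_\infty}\sum_{k=0}^{2t^2-2}(-1)^kq^{k^2+3k}\,f_{2,2t,1}\bigl(q^{2t+2-4t^2+2k},\,q^{2m};q\bigr)\\&\times\Bigl(\frac{1}{\Theta(-q;q^2)}\,f_{1,2t^2-1,2t^2(2t^2-1)}\bigl(-q^{2k+1},\,-q^{4t^2k-2+3t-4tm+4t^4};q^2\bigr)\\&\qquad-\frac{1}{\Theta(qx;q^2)}\,f_{1,2t^2-1,2t^2(2t^2-1)}\bigl(x^{-1}q^{2k+1},\,-q^{4t^2k-2+3t-4tm+4t^4};q^2\bigr)\Bigr).\end{aligned}$$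
   Context: Notation: $(a;q)_n=\prod_{k=1}^{n}(1-aq^{k-1})$ for $n\in\mathbb{N}\cup\{\infty\}$ and $(a)_n=(a;q)_n$; in particular $(q)_\infty=\prod_{k\ge1}(1-q^k)$ and $(q^2;q^2)_\infty=\prod_{k\ge1}(1-q^{2k})$. The theta function is $\Theta(x;q)=(x;q)_\infty(q/x;q)_\infty(q;q)_\infty=\sum_{n\in\mathbb{Z}}(-1)^nq^{\binom n2}x^n$; $\Theta(\cdot;q^2)$ means $q$ is replaced by $q^2$. Set $\mathrm{sg}(r)=1$ if $r\ge0$ and $\mathrm{sg}(r)=-1$ if $r<0$, and $\mathrm{sg}(r,s)=\frac{\mathrm{sg}(r)+\mathrm{sg}(s)}{2}$. For positive integers $a,b,c$ the Hecke-type double sum is $$f_{a,b,c}(x,y;q)=\sum_{r,s\in\mathbb{Z}}\mathrm{sg}(r,s)(-1)^{r+s}x^ry^sq^{a\binom r2+brs+c\binom s2},$$ and $f_{a,b,c}(x,y;q^2)$ means $q$ is replaced by $q^2$. Here $\binom{n}{2}=n(n-1)/2$ for every integer $n$. Define $$k_{t,m}(x;q)=\left(\sum_{r,s\ge0}-\sum_{r,s<0}\right)\frac{(-1)^{r+s}q^{2\binom r2+2trs+\binom s2+2(t+1)r+2ms}}{1-xq^{2r+1}},$$ $$\overline{k}_{t,m}(x;q)=\frac{xq}{1+x}\left(\frac1x\,k_{t,m}(-1;q)+k_{t,m}(x;q)\right),\qquad \mathcal{V}_t^{(m)}(x;q)=\frac{1}{(q)_\infty(q^2;q^2)_\infty}\,\overline{k}_{t,m}(x;q).$$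 *)

(* Defs.v *)
From HB Require Import structures.
From mathcomp Require Import all_boot all_order all_algebra.
From mathcomp Require Import finmap.
From mathcomp Require Export complex.
From mathcomp Require Import all_classical all_reals all_analysis.

Set Implicit Arguments.
Unset Strict Implicit.
Unset Printing Implicit Defensive.

Import Order.TTheory GRing.Theory Num.Theory.
Import numFieldNormedType.Exports.

Local Open Scope classical_set_scope.
Local Open Scope ring_scope.

(* The filter of finite subsets of I directed by inclusion. Limits along it
   are unordered (unconditional) sums. *)
Definition totally (I : choiceType) : set_system {fset I} :=
  filter_from [set: {fset I}] (fun A => [set B | (A `<=` B)%fset]).

Global Instance totally_filter (I : choiceType) : ProperFilter (@totally I).
Proof.
apply: filter_from_proper; last by move=> A _; exists A; exact: fsubset_refl.
apply: filter_from_filter; first by exists fset0.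
move=> A B _ _; exists (A `|` B)%fset => // C /=.
by rewrite fsubUset => /andP[AC BC].
Qed.

(* The sum of the F i over i in D, as an unordered sum; like lim, it is
   meaningful when the family is summable. *)
Definition usum (K : numFieldType) (I : choiceType) (D : {pred I})
    (F : I -> K) : K :=
  lim ((fun A : {fset I} => \sum_(i <- A | i \in D) F i) @ @totally I).

Definition qpoch (K : numFieldType) (a q : K) (n : nat) : K :=
  \prod_(1 <= k < n.+1) (1 - a * q ^+ (k - 1)%N).

Definition qpoch_inf (K : numFieldType) (a q : K) : K :=
  lim (qpoch a q n @[n --> \oo]).

Definition Theta (K : numFieldType) (x q : K) : K :=
  qpoch_inf x q * qpoch_inf (q / x) q * qpoch_inf q q.

(* n (n - 1) / 2 for every integer n; the division is exact. *)
Definition binz2 (n : int) : int := (n * (n - 1) %/ 2)%Z.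

Definition sg1 (K : numFieldType) (r : int) : K := if 0 <= r then 1 else -1.

Definition sg2 (K : numFieldType) (r s : int) : K := (sg1 K r + sg1 K s) / 2.

Definition hecke (K : numFieldType) (a b c : int) (x y q : K) : K :=
  usum predT (fun p : int * int => let: (r, s) := p in
    sg2 K r s * (-1) ^ (r + s) * x ^ r * y ^ s *
    q ^ (a * binz2 r + b * r * s + c * binz2 s)).

Definition kterm (K : numFieldType) (t m : int) (x q : K) (p : int * int) : K :=
  let: (r, s) := p in
  (-1) ^ (r + s) *
  q ^ (2 * binz2 r + 2 * t * r * s + binz2 s + 2 * (t + 1) * r + 2 * m * s) /
  (1 - x * q ^ (2 * r + 1)).

Definition ktm (K : numFieldType) (t m : int) (x q : K) : K :=
  usum [pred p : int * int | (0 <= p.1) && (0 <= p.2)] (kterm t m x q) -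
  usum [pred p : int * int | (p.1 < 0) && (p.2 < 0)] (kterm t m x q).

Definition kbar (K : numFieldType) (t m : int) (x q : K) : K :=
  x * q / (1 + x) * (x^-1 * ktm t m (-1) q + ktm t m x q).

Definition Vtm (K : numFieldType) (t m : int) (x q : K) : K :=
  (qpoch_inf q q * qpoch_inf (q ^+ 2) (q ^+ 2))^-1 * kbar t m x q.

(* Main.v *)
(* Put y = q x and Q = q^2, and let T(y) = sum_n (-1)^n q^(n(n-1)) y^n = Theta(y; Q).
   The Laurent coefficients in y of y T(y) / (1 - y Q^r) can be written either as
   partial theta sums over j >= 0 or as minus the sums over j < 0, because T vanishes
   at powers of Q. Choosing the first form for N <= 0 and the second for N >= 1 makes
   the sum of y T(y) k_{t,m}(x; q) over (r, s, N, j) absolutely convergent. Summing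
   over (r, s) first gives a double sum over (N, j) in the Hecke sums
   Phi(j) = f_{2,2t,1}(q^(2(t+1+j)), q^(2m); q). Shifting (r, s) by (1, -2t) produces
   no boundary terms, again since theta functions vanish at powers of their base, so
   Phi(j + 2t^2 - 1) is an explicit monomial times Phi(j). Writing
   j = k - 1 + (2t^2 - 1) u with 0 <= k < 2t^2 - 1 turns the (N, u) sums into the
   positive definite Hecke sums, except that the condition j >= 0 becomes j >= -1;
   this costs the term -Phi(-1) T(y). Hence x q k_{t,m}(x; q) plus the claimed theta
   quotient is the constant -Phi(-1), and comparing with x = -1 eliminates it. *)

Require Import Defs.
From mathcomp Require Import all_boot all_order all_algebra.
From mathcomp Require Import finmap.
From mathcomp Require Import all_classical all_reals all_analysis.
From mathcomp Require Import ring lra zify.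

Set Implicit Arguments.
Unset Strict Implicit.
Unset Printing Implicit Defensive.

Import Order.TTheory GRing.Theory Num.Theory.
Import numFieldNormedType.Exports.
Local Open Scope ring_scope.

(** * The modulus on R[i] and unordered sums *)

Section Modulus.
Variable R : realType.
Implicit Types (x y z : R[i]) (n : nat).

Definition cmod z : R := Normc.normc z.

Lemma normcC z : `|z| = (cmod z)%:C%C. Proof. by []. Qed.

Lemma cmod0 : cmod 0 = 0. Proof. exact: Normc.normc0. Qed.
Lemma cmod1 : cmod 1 = 1. Proof. exact: Normc.normc1. Qed.
Lemma cmodM x y : cmod (x * y) = cmod x * cmod y.
Proof. exact: Normc.normcM. Qed.
Lemma cmodV x : cmod x^-1 = (cmod x)^-1. Proof. exact: Normc.normcV. Qed.
Lemma cmodN x : cmod (- x) = cmod x. Proof. exact: normcN. Qed.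
Lemma cmod_ge0 x : 0 <= cmod x. Proof. by case: x => a b; exact: sqrtr_ge0. Qed.
Lemma ler_cmodD x y : cmod (x + y) <= cmod x + cmod y.
Proof. exact: le_normcD. Qed.
Lemma ler_cmodB x y : cmod (x - y) <= cmod x + cmod y.
Proof. by rewrite -(cmodN y) ler_cmodD. Qed.
Lemma cmodBC x y : cmod (x - y) = cmod (y - x).
Proof. by rewrite -cmodN opprB. Qed.
Lemma cmod_eq0 x : (cmod x == 0) = (x == 0).
Proof.
by apply/eqP/eqP => [/Normc.eq0_normc|->]; last exact: cmod0.
Qed.
Lemma cmod_gt0 x : (0 < cmod x) = (x != 0).
Proof. by rewrite lt_neqAle cmod_ge0 andbT eq_sym cmod_eq0. Qed.
Lemma cmodX x n : cmod (x ^+ n) = cmod x ^+ n.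
Proof. by elim: n => [|n IH]; rewrite ?expr0 ?cmod1 // !exprS cmodM IH. Qed.
Lemma cmodXz x (n : int) : cmod (x ^ n) = cmod x ^ n.
Proof. by case: n => n; rewrite ?NegzE -?exprnP -?exprnN ?cmodV cmodX. Qed.
Lemma ler_cmod_sum (I : Type) (s : seq I) (P : pred I) (F : I -> R[i]) :
  cmod (\sum_(i <- s | P i) F i) <= \sum_(i <- s | P i) cmod (F i).
Proof.
elim/big_ind2: _ => //; first by rewrite cmod0.
by move=> a b c d h1 h2; apply: le_trans (ler_cmodD _ _) (lerD h1 h2).
Qed.
Lemma ler_cmod_ReIm z : cmod z <= `|complex.Re z| + `|complex.Im z|.
Proof.
case: z => a b /=; rewrite /cmod /= -[leRHS]ger0_norm ?addr_ge0// -sqrtr_sqr ler_sqrt ?sqr_ge0//.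
rewrite sqrrD !real_normK ?num_real// -addrA [_ *+ _ + _]addrC addrA lerDl.
by rewrite mulrn_wge0// mulr_ge0.
Qed.
Lemma ler_Re_cmod z : `|complex.Re z| <= cmod z.
Proof.
by case: z => a b; rewrite /cmod /= -sqrtr_sqr ler_sqrt ?lerDl ?sqr_ge0// addr_ge0 ?sqr_ge0.
Qed.
Lemma ler_Im_cmod z : `|complex.Im z| <= cmod z.
Proof.
by case: z => a b; rewrite /cmod /= -sqrtr_sqr ler_sqrt ?lerDr ?sqr_ge0// addr_ge0 ?sqr_ge0.
Qed.
Lemma cmod_real (r : R) : 0 <= r -> cmod r%:C%C = r.
Proof. by move=> r0; rewrite /cmod /= expr0n /= addr0 sqrtr_sqr ger0_norm. Qed.

(** A positive element of [R[i]] has zero imaginary part, so the epsilon of the norm on [R[i]]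
    amounts to a real one. *)
Lemma cvgC_cmodP (T : Type) (F : set_system T) (FF : Filter F)
    (f : T -> R[i]) (l : R[i]) :
  (f @ F --> (l : (R[i] : numFieldType)))%classic <->
  forall e : R, 0 < e -> \forall x \near F, cmod (l - f x) <= e.
Proof.
rewrite (@cvgrPdist_le R[i] (R[i] : numFieldType)^o); split=> h e e0.
  have /h : 0 < e%:C%C :> R[i] by rewrite ltcR.
  by apply: filterS => x; rewrite normcC lecR.
move: e0; rewrite ltcE /= => /andP[/eqP ei er].
have /h := er; apply: filterS => x; rewrite normcC lecE /= ei eqxx.
by [].
Qed.

End Modulus.

Arguments cmod {R} z : simpl never.

Lemma num_cvg_lim (K : numFieldType) (T : Type) (F : set_system T)
    (FF : ProperFilter F) (f : T -> K) (l : K) :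
  (f @ F --> l)%classic -> (lim (f @ F)%classic : K) = l.
Proof. by apply: (@cvg_lim K^o); exact: norm_hausdorff. Qed.

(** * Unordered sums of complex families: absolute convergence, interchange, dominated limits *)

Section UnorderedSums.
Variable R : realType.
Local Notation C := R[i].

(** [usum] is a [lim], whose value says nothing when the family diverges. This relation carries
    convergence together with the value; [usum_has_sum] leads back to [usum]. *)
Definition has_sum (I : choiceType) (F : I -> C) (S : C) :=
  forall e : R, 0 < e -> exists A0 : {fset I}, forall A : {fset I},
    (A0 `<=` A)%fset -> cmod (S - \sum_(i <- A) F i) <= e.

Definition abs_summable (I : choiceType) (F : I -> C) :=
  exists M : R, forall A : {fset I}, \sum_(i <- A) cmod (F i) <= M.

Lemma fsum_split (V : nmodType) (I : choiceType) (A B : {fset I}) (f : I -> V) :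
  (A `<=` B)%fset ->
  \sum_(i <- B) f i = \sum_(i <- A) f i + \sum_(i <- (B `\` A)%fset) f i.
Proof.
move=> AB; rewrite (big_fsetID _ (mem A)) /=; congr (_ + _).
  apply: eq_fbigl => x; rewrite !inE andbC; case: (boolP (x \in A)) => //= xA.
  by rewrite (fsubsetP AB).
by apply: eq_fbigl => x; rewrite !inE andbC.
Qed.

Lemma sum_fset_seq (V : nmodType) (I : choiceType) (s : seq I) (f : I -> V) :
  uniq s -> \sum_(i <- [fset i in s]%fset) f i = \sum_(i <- s) f i.
Proof.
move=> us; apply: perm_big; apply: uniq_perm; rewrite ?fset_uniq// => x.
by rewrite inE.
Qed.

Lemma has_sum_unique (I : choiceType) (F : I -> C) S S' :
  has_sum F S -> has_sum F S' -> S = S'.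
Proof.
move=> h h'; apply/eqP; rewrite -subr_eq0 -cmod_eq0 eq_le cmod_ge0 andbT.
apply/ler_addgt0Pr => e e0; rewrite add0r.
have e2 : 0 < e / 2 by rewrite divr_gt0.
have [A hA] := h _ e2; have [B hB] := h' _ e2.
have := hA _ (fsubsetUl A B); have := hB _ (fsubsetUr A B).
set s := \sum_(_ <- _) _ => hb ha.
rewrite (_ : S - S' = (S - s) - (S' - s)); last by ring.
by apply: le_trans (ler_cmodB _ _) _; rewrite [leRHS]splitr lerD.
Qed.

Lemma usum_has_sum (I : choiceType) (F : I -> C) S :
  has_sum F S -> usum predT F = S.
Proof.
move=> h; apply: num_cvg_lim; apply/cvgC_cmodP => e /h [A0 hA0].
by exists A0 => // A; exact: hA0.
Qed.

Lemma usum_mkcond (I : choiceType) (D : {pred I}) (F : I -> C) :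
  usum D F = usum predT (fun i => if i \in D then F i else 0).
Proof.
by rewrite /usum; do 2 f_equal; apply/funext => A; rewrite big_mkcond.
Qed.

(** The sum over [A0] can be brought within [e] of the supremum of all finite sums of moduli, so a
    set disjoint from [A0] adds at most [e]. *)
Lemma abs_summable_tail (I : choiceType) (F : I -> C) : abs_summable F ->
  forall e : R, 0 < e -> exists A0 : {fset I}, forall B : {fset I},
    [disjoint A0 & B]%fset -> \sum_(i <- B) cmod (F i) <= e.
Proof.
move=> [M hM] e e0.
pose E := [set \sum_(i <- A) cmod (F i) | A in [set: {fset I}]]%classic.
have supE : has_sup E.
  split; first by exists (\sum_(i <- fset0) cmod (F i)); exists fset0.
  by exists M => _ [A _ <-]; exact: hM.
have [_ [A _ <-] hA] := sup_adherent e0 supE.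
exists A => B dAB; have := @sup_upper_bound _ E supE _
  (ex_intro2 _ _ (A `|` B)%fset Logic.I erefl).
rewrite (fsum_split _ (fsubsetUl A B)).
rewrite (_ : (A `|` B) `\` A = B)%fset; first by move: hA; lra.
apply/fsetP => x; rewrite !inE; move/fdisjointP: dAB => /(_ x).
by case: (x \in A) => //= /(_ isT) /negbTE ->.
Qed.

Lemma abs_summable_le (I : choiceType) (F G : I -> C) :
  (forall i, cmod (F i) <= cmod (G i)) -> abs_summable G -> abs_summable F.
Proof.
move=> FG [M hM]; exists M => A; apply: le_trans (hM A).
by apply: ler_sum => i _; exact: FG.
Qed.

Lemma real_has_sum (I : choiceType) (f : I -> R) (M : R) :
  (forall i, 0 <= f i) -> (forall A : {fset I}, \sum_(i <- A) f i <= M) ->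
  exists s, forall e : R, 0 < e -> exists A0 : {fset I}, forall A : {fset I},
    (A0 `<=` A)%fset -> `|s - \sum_(i <- A) f i| <= e.
Proof.
move=> f0 hM; pose E := [set \sum_(i <- A) f i | A in [set: {fset I}]]%classic.
have supE : has_sup E.
  split; first by exists (\sum_(i <- fset0) f i); exists fset0.
  by exists M => _ [A _ <-]; exact: hM.
exists (sup E) => e e0; have [_ [A _ <-] hA] := sup_adherent e0 supE.
exists A => B AB; have := @sup_upper_bound _ E supE _
  (ex_intro2 _ _ B Logic.I erefl).
rewrite (fsum_split _ AB).
have : 0 <= \sum_(i <- (B `\` A)%fset) f i by apply: sumr_ge0.
by move: hA => /= hA h1 h2; rewrite ger0_norm; lra.
Qed.

Lemma abs_summable_has_sum (I : choiceType) (F : I -> C) :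
  abs_summable F -> has_sum F (usum predT F).
Proof.
move=> [M hM].
suff [S hS] : exists S, has_sum F S by rewrite (usum_has_sum hS).
(* To be used for the real and the imaginary part. The family [g + cmod] is nonnegative with finite
   sums at most [M + M], so it has a supremum as sum, and subtracting the sum of [cmod] leaves the
   sum of [g]. *)
have sumC (g : C -> R) : (forall z, `|g z| <= cmod z) -> exists s,
    forall e : R, 0 < e -> exists A0 : {fset I}, forall A : {fset I},
    (A0 `<=` A)%fset -> `|s - \sum_(i <- A) g (F i)| <= e.
  move=> gle.
  have [||u hu] := @real_has_sum I (fun i => cmod (F i)) M.
  - by move=> i; exact: cmod_ge0.
  - exact: hM.
  have [||v hv] := @real_has_sum I (fun i => g (F i) + cmod (F i)) (M + M).
  - by move=> i; have := gle (F i); rewrite ler_norml => /andP[? _]; lra.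
  - move=> A; rewrite big_split/=; apply: lerD => //; apply: le_trans (hM A).
    by apply: ler_sum => i _; apply: le_trans (gle _); exact: ler_norm.
  exists (v - u) => e e0; have e2 : 0 < e / 2 by rewrite divr_gt0.
  have [A hA] := hu _ e2; have [B hB] := hv _ e2.
  exists (A `|` B)%fset => D; rewrite fsubUset => /andP[/hA hA' /hB hB'].
  move: hA' hB'; rewrite big_split/= !ler_norml => /andP[? ?] /andP[? ?].
  by apply/andP; split; lra.
have [a ha] := sumC _ (@ler_Re_cmod R); have [b hb] := sumC _ (@ler_Im_cmod R).
exists (a +i* b)%C => e e0; have e2 : 0 < e / 2 by rewrite divr_gt0.
have [A hA] := ha _ e2; have [B hB] := hb _ e2.
exists (A `|` B)%fset => D; rewrite fsubUset => /andP[/hA hA' /hB hB'].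
apply: le_trans (ler_cmod_ReIm _) _; rewrite [leRHS]splitr.
have -> : \sum_(i <- D) F i =
    ((\sum_(i <- D) complex.Re (F i)) +i* (\sum_(i <- D) complex.Im (F i)))%C.
  elim/big_rec3: _ => // i x y z _ ->; by case: (F i).
exact: lerD.
Qed.

Lemma has_sumD (I : choiceType) (F G : I -> C) S T :
  has_sum F S -> has_sum G T -> has_sum (fun i => F i + G i) (S + T).
Proof.
move=> hF hG e e0; have e2 : 0 < e / 2 by rewrite divr_gt0.
have [A hA] := hF _ e2; have [B hB] := hG _ e2.
exists (A `|` B)%fset => D; rewrite fsubUset => /andP[/hA hA' /hB hB'].
rewrite big_split/= opprD addrACA [leRHS]splitr.
by apply: le_trans (ler_cmodD _ _) _; exact: lerD.
Qed.

Lemma has_sumZ (I : choiceType) (F : I -> C) S (c : C) :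
  has_sum F S -> has_sum (fun i => c * F i) (c * S).
Proof.
move=> hF e e0.
(* The [+ 1] keeps the divisor positive when [c = 0]. *)
have e1 : 0 < e / (cmod c + 1) by rewrite divr_gt0// ltr_wpDl// cmod_ge0.
have [A hA] := hF _ e1; exists A => B /hA {}hA.
rewrite -mulr_sumr -mulrBr cmodM.
apply: le_trans (_ : (cmod c + 1) * (e / (cmod c + 1)) <= _).
  by apply: ler_pM; rewrite ?cmod_ge0// lerDl.
by rewrite mulrC divfK// gt_eqF// ltr_wpDl// cmod_ge0.
Qed.

Lemma has_sumB (I : choiceType) (F G : I -> C) S T :
  has_sum F S -> has_sum G T -> has_sum (fun i => F i - G i) (S - T).
Proof.
move=> hF /(has_sumZ (-1)) hG; rewrite -mulN1r.
by under eq_fun do rewrite -mulN1r; exact: has_sumD.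
Qed.

Lemma abs_summableD (I : choiceType) (F G : I -> C) :
  abs_summable F -> abs_summable G -> abs_summable (fun i => F i + G i).
Proof.
move=> [M hM] [N hN]; exists (M + N) => A.
apply: le_trans (lerD (hM A) (hN A)); rewrite -big_split/=.
by apply: ler_sum => i _; exact: ler_cmodD.
Qed.

Lemma abs_summableZ (I : choiceType) (F : I -> C) (c : C) :
  abs_summable F -> abs_summable (fun i => c * F i).
Proof.
move=> [M hM]; exists (cmod c * M) => A.
under eq_bigr do rewrite cmodM; rewrite -mulr_sumr.
by rewrite ler_wpM2l ?cmod_ge0.
Qed.

Lemma has_sum_finite (I : choiceType) (F : I -> C) (A : {fset I}) :
  (forall i, i \notin A -> F i = 0) -> has_sum F (\sum_(i <- A) F i).
Proof.
move=> h e e0; exists A => B AB; rewrite (fsum_split _ AB) opprD addNKr cmodN.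
rewrite big_seq big1 ?cmod0 ?ltW// => i; rewrite !inE => /andP[/h].
by [].
Qed.

Section Reindex.
Variables (I J : choiceType) (h : J -> I) (g : I -> J).
Hypotheses (hK : cancel h g) (gK : cancel g h).

Lemma sum_imfset (V : nmodType) (F : I -> V) (A : {fset J}) :
  \sum_(i <- (h @` A)%fset) F i = \sum_(j <- A) F (h j).
Proof. by rewrite big_imfset //= => x y _ _; exact: (can_inj hK). Qed.

Lemma has_sum_reindex (F : I -> C) S :
  has_sum F S -> has_sum (fun j => F (h j)) S.
Proof.
move=> hF e /hF [A hA]; exists (g @` A)%fset => B AB.
rewrite -(sum_imfset F); apply: hA; apply/fsubsetP => x xA.
apply/imfsetP; exists (g x); rewrite ?gK//.
by apply: (fsubsetP AB); apply/imfsetP; exists x.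
Qed.

Lemma abs_summable_reindex (F : I -> C) :
  abs_summable F -> abs_summable (fun j => F (h j)).
Proof. by move=> [M hM]; exists M => A; rewrite -(sum_imfset (fun i => cmod (F i))). Qed.

End Reindex.

Lemma ler_fsum_seq (I : choiceType) (f : I -> R) (A : {fset I}) (s : seq I) :
  (forall i, 0 <= f i) -> uniq s -> {subset A <= s} ->
  \sum_(i <- A) f i <= \sum_(i <- s) f i.
Proof.
move=> f0 us As; rewrite -(sum_fset_seq f us).
rewrite [leRHS](@fsum_split _ _ A).
  by rewrite lerDl sumr_ge0.
by apply/fsubsetP => x /As; rewrite inE.
Qed.

Lemma sum_fsetM (V : nmodType) (I J : choiceType) (F : I * J -> V)
    (A : {fset I}) (B : {fset J}) :
  \sum_(p <- (A `*` B)%fset) F p = \sum_(i <- A) \sum_(j <- B) F (i, j).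
Proof.
rewrite -big_allpairs.
apply: perm_big; apply: uniq_perm; rewrite ?fset_uniq//.
  apply: allpairs_uniq; rewrite ?fset_uniq//.
  by move=> [? ?] [? ?] _ _ [-> ->].
move=> [i j]; rewrite inE /=; apply/andP/allpairsP => [[iA jB]|[[a b] /= [? ? [-> ->]]]].
  by exists (i, j).
by [].
Qed.

Lemma sub_fsetM (I J : choiceType) (A : {fset I * J}) :
  (A `<=` [fset p.1 | p in A] `*` [fset p.2 | p in A])%fset.
Proof.
apply/fsubsetP => -[i j] ijA; rewrite inE /=; apply/andP; split.
  by apply/imfsetP; exists (i, j).
by apply/imfsetP; exists (i, j).
Qed.

Lemma abs_summableM (I J : choiceType) (F : I -> C) (G : J -> C) :
  abs_summable F -> abs_summable G ->
  abs_summable (fun p : I * J => F p.1 * G p.2).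
Proof.
move=> [M hM] [N hN]; exists (M * N) => A.
apply: le_trans (_ : \sum_(p <- ([fset p.1 | p in A] `*` [fset p.2 | p in A])%fset)
   cmod (F p.1 * G p.2) <= _).
  by rewrite (fsum_split _ (sub_fsetM A)) lerDl sumr_ge0// => i _; exact: cmod_ge0.
rewrite sum_fsetM; under eq_bigr do under eq_bigr do rewrite cmodM /=.
under eq_bigr do rewrite -mulr_sumr.
rewrite -mulr_suml ler_pM// sumr_ge0// => i _; exact: cmod_ge0.
Qed.

Section Fubini.
Variables (I J : choiceType) (F : I * J -> C).
Hypothesis sF : abs_summable F.

Lemma abs_summable_row i : abs_summable (fun j => F (i, j)).
Proof.
move: sF => [M hM]; exists M => A; apply: le_trans (hM ([fset i] `*` A)%fset).
by rewrite sum_fsetM big_seq_fset1.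
Qed.

Let row i := usum predT (fun j => F (i, j)).

(** One finite set of columns serves finitely many rows at once: each new row takes half of the
    remaining error. *)
Lemma finite_rows_approx (s : seq I) (e : R) : 0 < e ->
  exists B0 : {fset J}, forall B : {fset J}, (B0 `<=` B)%fset ->
    \sum_(i <- s) cmod (row i - \sum_(j <- B) F (i, j)) <= e.
Proof.
elim: s e => [|i s IH] e e0.
  by exists fset0 => B _; rewrite big_nil ltW.
have e2 : 0 < e / 2 by rewrite divr_gt0.
have [A hA] := IH _ e2.
have [B hB] := abs_summable_has_sum (abs_summable_row i) e2.
exists (A `|` B)%fset => D; rewrite fsubUset => /andP[/hA hA' /hB hB'].
by rewrite big_cons [leRHS]splitr lerD.
Qed.

Lemma abs_summable_rows : abs_summable row.
Proof.
move: sF => [M hM]; exists M => A; apply/ler_addgt0Pr => e e0.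
have [B hB] := finite_rows_approx A e0; have {}hB := hB B (fsubset_refl _).
apply: le_trans (lerD (hM (A `*` B)%fset) hB).
rewrite sum_fsetM -big_split/=; apply: ler_sum => i _.
have := ler_cmodD (\sum_(j <- B) F (i, j)) (row i - \sum_(j <- B) F (i, j)).
by rewrite [X in cmod X]addrC subrK => /le_trans; apply; rewrite lerD2r ler_cmod_sum.
Qed.

(** Fubini. Once [A] contains the row indices of a good finite set [A0], the columns can be enlarged
    to a [D] for which the rectangle contains [A0] and the rows in [A] are almost exhausted. *)
Lemma has_sum_rows : has_sum row (usum predT F).
Proof.
move=> e e0; have e2 : 0 < e / 2 by rewrite divr_gt0.
have [A0 hA0] := abs_summable_has_sum sF e2.
exists [fset p.1 | p in A0]%fset => A sA.
have [B hB] := finite_rows_approx A e2.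
have {}hB := hB (B `|` [fset p.2 | p in A0])%fset (fsubsetUl _ _).
set D := (B `|` _)%fset in hB.
have /hA0 : (A0 `<=` A `*` D)%fset.
  apply: fsubset_trans (sub_fsetM A0) _; apply/fsubsetP => p; rewrite !inE.
  by move=> /andP[/(fsubsetP sA) -> ->]; rewrite orbT.
rewrite sum_fsetM => h; rewrite [leRHS]splitr.
set x := \sum_(i <- A) _ in h *.
rewrite -(subrKA x); apply: le_trans (ler_cmodD _ _) (lerD h _).
apply: le_trans hB; rewrite /x -sumrB.
apply: le_trans (ler_cmod_sum _ _ _) _; apply: ler_sum => i _.
by rewrite cmodBC.
Qed.

End Fubini.

Lemma has_sum_cols (I J : choiceType) (F : I * J -> C) : abs_summable F ->
  has_sum (fun j => usum predT (fun i => F (i, j))) (usum predT F).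
Proof.
move=> sF; pose sw (p : J * I) := (p.2, p.1); pose sw' (p : I * J) := (p.2, p.1).
have swK : cancel sw sw' by case. have sw'K : cancel sw' sw by case.
have := has_sum_rows (abs_summable_reindex swK sF).
rewrite [X in has_sum _ X](_ : _ = usum predT F)//; apply: usum_has_sum.
exact: has_sum_reindex swK sw'K _ _ (abs_summable_has_sum sF).
Qed.

Lemma has_sum_tail (I : choiceType) (F : I -> C) (S : C) (A : {fset I}) (e : R) :
  has_sum F S ->
  (forall B : {fset I}, [disjoint A & B]%fset -> \sum_(i <- B) cmod (F i) <= e) ->
  cmod (S - \sum_(i <- A) F i) <= e.
Proof.
move=> hS hA; apply/ler_addgt0Pr => d /hS[B hB].
have {hB} := hB _ (fsubsetUr A B).
rewrite (fsum_split _ (fsubsetUl A B)) => h.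
have /hA h' : [disjoint A & (A `|` B) `\` A]%fset.
  by apply/fdisjointP => x xA; rewrite inE xA.
have := ler_cmod_sum ((A `|` B) `\` A)%fset predT F.
set a := \sum_(i <- A) F i in h *.
set b := \sum_(i <- ((A `|` B) `\` A)%fset) F i in h * => hb.
rewrite (_ : S - a = (S - (a + b)) + b); last by ring.
apply: le_trans (ler_cmodD _ _) _; rewrite [leRHS]addrC.
by apply: lerD h _; exact: le_trans hb h'.
Qed.

(** Tannery's theorem: outside a finite set [A] everything is at most [e / 3], uniformly in the
    parameter, and on [A] the limit is that of a finite sum. *)
Lemma has_sum_dominated_cvg (I : choiceType) (T : Type) (E : set_system T)
    (FE : Filter E) (f : T -> I -> C) (g G : I -> C) (S : T -> C) (S0 : C) :
  abs_summable G -> (forall n i, cmod (f n i) <= cmod (G i)) ->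
  (forall i, cmod (g i) <= cmod (G i)) ->
  (forall i, (f ^~ i @ E --> (g i : (C : numFieldType)))%classic) ->
  (forall n, has_sum (f n) (S n)) -> has_sum g S0 ->
  (S @ E --> (S0 : (C : numFieldType)))%classic.
Proof.
move=> sG fG gG fg hS hS0; apply/cvgC_cmodP => e e0.
have e3 : 0 < e / 3 by rewrite divr_gt0.
have [A hA] := abs_summable_tail sG e3.
have tailG (F : I -> C) (U : C) : (forall i, cmod (F i) <= cmod (G i)) ->
    has_sum F U -> cmod (U - \sum_(i <- A) F i) <= e / 3.
  move=> FG hF; apply: has_sum_tail hF _ => B /hA; apply: le_trans.
  by apply: ler_sum => i _.
have fin : \forall n \near E, cmod (\sum_(i <- A) g i - \sum_(i <- A) f n i) <= e / 3.
  elim: (enum_fset A) (e / 3) e3 => [|i s IH] d d0.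
    by apply: nearW => n; rewrite !big_nil subrr cmod0 ltW.
  have d2 : 0 < d / 2 by rewrite divr_gt0.
  have /cvgC_cmodP/(_ _ d2) hi := fg i.
  apply: filterS2 hi (IH _ d2) => n h1 h2.
  rewrite !big_cons opprD addrACA [leRHS]splitr.
  exact: le_trans (ler_cmodD _ _) (lerD h1 h2).
apply: filterS fin => n hn.
have h1 := tailG _ _ gG hS0; have h2 := tailG _ _ (fG n) (hS n).
set a := \sum_(i <- A) g i in hn h1; set b := \sum_(i <- A) f n i in hn h2.
rewrite (_ : S0 - S n = (S0 - a) + ((a - b) - (S n - b))); last by ring.
apply: le_trans (ler_cmodD _ _) _; have := ler_cmodB (a - b) (S n - b).
by lra.
Qed.

End UnorderedSums.

(** * Geometric majorants in powers of [|q|] *)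

Section Majorants.
Variables (R : realType) (q : R[i]).
Hypotheses (q0 : q != 0) (q1 : cmod q < 1).
Local Notation C := R[i].

Lemma ler_cmod_expz (m n : int) : m <= n -> cmod q ^ n <= cmod q ^ m.
Proof.
move=> mn; rewrite -(subrK m n) expfzDr ?cmod_eq0//.
have : 0 <= n - m by lia.
case: (n - m) => // k _; rewrite ler_piMl ?exprz_ge0 ?cmod_ge0//.
by rewrite -exprnP exprn_ile1 ?cmod_ge0// ltW.
Qed.

Lemma abs_summable_expn : abs_summable (fun n : nat => q ^+ n).
Proof.
exists (1 - cmod q)^-1 => A; pose N := (\max_(i <- A) i).+1.
apply: le_trans (_ : \sum_(i <- iota 0 N) cmod (q ^+ i) <= _).
  apply: ler_fsum_seq => [i||i iA]; rewrite ?cmod_ge0 ?iota_uniq//.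
  by rewrite mem_iota/= add0n ltnS; exact: leq_bigmax_seq.
under eq_bigr do rewrite cmodX.
rewrite -[iota 0 N]/(index_iota 0 N) big_mkord.
rewrite -[leRHS]mul1r ler_pdivlMr ?subr_gt0// mulrC -opprB mulNr -subrX1 opprB.
by rewrite gerDl oppr_le0 exprn_ge0// cmod_ge0.
Qed.

Lemma abs_summable_expz : abs_summable (fun n : int => q ^+ `|n|%N).
Proof.
have [M hM] := abs_summable_expn; exists (M + M) => A.
have [N hN] : exists N, forall i, i \in A -> (`|i| < N)%N.
  exists (\max_(i <- A) `|i|).+1 => i iA.
  by rewrite ltnS; apply: leq_bigmax_seq iA _.
apply: le_trans (_ : \sum_(i <- map Posz (iota 0 N) ++ map Negz (iota 0 N))
    cmod (q ^+ `|i|) <= _).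
  apply: ler_fsum_seq => [i||i iA]; first exact: cmod_ge0.
    rewrite cat_uniq !map_inj_uniq ?iota_uniq ?andbT/=; try by move=> ? ? [].
    by apply/hasPn => _ /mapP[n _ ->]; apply/negP => /mapP[].
  have := hN _ iA; rewrite mem_cat; case: i {iA} => n /= hn; apply/orP; [left|right].
    by apply/mapP; exists n => //; rewrite mem_iota.
  by apply/mapP; exists n => //; rewrite mem_iota/= ltnW.
have h : \sum_(i <- iota 0 N) cmod (q ^+ i) <= M.
  by rewrite -sum_fset_seq ?iota_uniq.
rewrite big_cat !big_map; apply: lerD; rewrite //=.
apply: le_trans h; apply: ler_sum => i _; rewrite !cmodX exprS.
by rewrite ler_piMl ?exprn_ge0 ?cmod_ge0// ltW.
Qed.

(** Reduces the convergence of the theta, Hecke and fourfold sums to an integer inequality: the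
    exponent of [|q|] must be at least the weight of the index up to a constant [c]. *)
Lemma abs_summable_majorant (I : choiceType) (w : I -> nat) (F : I -> C) (c : int) :
  abs_summable (fun i => q ^+ w i) ->
  (forall i, cmod (F i) <= cmod q ^ ((w i)%:Z - c)) -> abs_summable F.
Proof.
move=> hw hF; have := abs_summableZ (q ^ (- c)) hw; apply: abs_summable_le => i.
apply: le_trans (hF i) _; rewrite -[q ^+ _]/(q ^ (w i : int)) -expfzDr// cmodXz.
by rewrite addrC.
Qed.

Definition weight2 (p : int * int) := (`|p.1| + `|p.2|)%N.
Definition weight4 (p : (int * int) * (int * int)) := (weight2 p.1 + weight2 p.2)%N.

Lemma abs_summable_weight2 : abs_summable (fun p => q ^+ weight2 p).
Proof.
under eq_fun do rewrite exprD.
exact: (abs_summableM abs_summable_expz abs_summable_expz).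
Qed.

Lemma abs_summable_weight4 : abs_summable (fun p => q ^+ weight4 p).
Proof.
under eq_fun do rewrite exprD.
exact: (abs_summableM abs_summable_weight2 abs_summable_weight2).
Qed.

(** Turns powers of an arbitrary nonzero [z] into a linear term in the exponent of [|q|]. Some power
    [|q|^L] lies below both [|z|] and [1 / |z|], which covers both signs of [n]. *)
Lemma ler_cmod_expz_of_le (z : C) : z != 0 ->
  exists L : nat, forall n : int, cmod z ^ n <= cmod q ^ (- (L%:Z * `|n|)).
Proof.
move=> z0; have z1 : 0 < cmod z by rewrite cmod_gt0.
have [L [h1 h2]] : exists L, cmod q ^+ L <= cmod z /\ cmod q ^+ L <= (cmod z)^-1.
  have /cvgrPdist_le h : (cmod q ^+ n @[n --> \oo] --> (0 : R))%classic.
    by apply: cvg_expr; rewrite ger0_norm ?cmod_ge0.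
  have /h [a _ ha] := z1.
  have /h [b _ hb] : 0 < (cmod z)^-1 by rewrite invr_gt0.
  exists (a + b)%N; split.
    have := ha (a + b)%N (leq_addr _ _).
    by rewrite sub0r normrN ger0_norm// exprn_ge0// cmod_ge0.
  have := hb (a + b)%N (leq_addl _ _).
  by rewrite sub0r normrN ger0_norm// exprn_ge0// cmod_ge0.
have qL : 0 < cmod q ^+ L by rewrite exprn_gt0// cmod_gt0.
have powE (k : nat) : cmod q ^ (- (L%:Z * k%:Z)) = ((cmod q ^+ L)^-1) ^+ k.
  by rewrite -exprz_inv -PoszM -exprnP exprM -exprVn.
exists L => -[n|n]; rewrite powE ?NegzE.
  rewrite -exprnP; apply: lerXn2r; rewrite ?nnegrE ?cmod_ge0 ?invr_ge0 ?(ltW qL)//.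
  by rewrite -[leLHS]invrK lef_pV2 ?posrE ?invr_gt0.
rewrite -exprnN -exprVn; apply: lerXn2r; rewrite ?nnegrE ?invr_ge0 ?cmod_ge0 ?(ltW qL)//.
by rewrite lef_pV2 ?posrE.
Qed.

End Majorants.

(** * Infinite products and the Jacobi triple product *)

(** A relation without division, usable by [lia], [nia] and exponent computations. *)
Lemma binz2_double (n : int) : 2 * binz2 n = n * (n - 1).
Proof.
rewrite /binz2 mulrC divzK//.
have -> : n = (n %/ 2)%Z * 2 + (n %% 2)%Z by exact: divz_eq.
have : (n %% 2)%Z = 0 \/ (n %% 2)%Z = 1 by lia.
set k := (n %/ 2)%Z; case=> ->; apply/dvdzP.
  by exists (k * (k * 2 - 1)); ring.
by exists ((k * 2 + 1) * k); ring.
Qed.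

Lemma binz2_nat (n : nat) : binz2 n = 'C(n, 2)%:Z.
Proof.
have := binz2_double n; have := bin2_sum n.
elim: n => [|n IH]; first by [].
by move=> _; have := binz2_double n; have := IH (bin2_sum n) (binz2_double n);
  rewrite binS bin1; lia.
Qed.

Section QPochhammer.
Variables (R : realType) (q : R[i]).
Hypotheses (q0 : q != 0) (q1 : cmod q < 1).
Local Notation C := (R[i] : numFieldType).
Implicit Types (a x z : R[i]) (m n : nat).

Lemma qpoch0 a : qpoch a q 0 = 1. Proof. by rewrite /qpoch big_nil. Qed.

Lemma qpochS a n : qpoch a q n.+1 = qpoch a q n * (1 - a * q ^+ n).
Proof. by rewrite /qpoch big_nat_recr//= subn1. Qed.

Lemma qpochD a m n : qpoch a q (m + n) = qpoch a q m * qpoch (a * q ^+ m) q n.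
Proof.
elim: n => [|n IH]; first by rewrite addn0 qpoch0 mulr1.
by rewrite addnS !qpochS IH -!mulrA -exprD.
Qed.

Lemma qpoch_neq0 a n : (forall k : nat, 1 - a * q ^+ k != 0) -> qpoch a q n != 0.
Proof. by move=> h; elim: n => [|n IH]; rewrite ?qpoch0 ?oner_eq0// qpochS mulf_neq0. Qed.

Lemma geo_sum_le n : \sum_(i < n) cmod q ^+ i <= (1 - cmod q)^-1.
Proof.
rewrite -[leRHS]mul1r ler_pdivlMr ?subr_gt0// mulrC -opprB mulNr -subrX1 opprB.
by rewrite gerDl oppr_le0 exprn_ge0// cmod_ge0.
Qed.

(** Comes from [1 + u <= exp u] applied to each factor; it bounds all partial products at once. *)
Definition qpoch_bound a : R := expR (cmod a * (1 - cmod q)^-1).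

Lemma qpoch_bound_gt0 a : 0 < qpoch_bound a. Proof. exact: expR_gt0. Qed.

Lemma ler_qpoch_bound a n : cmod (qpoch a q n) <= qpoch_bound a.
Proof.
apply: le_trans (_ : expR (cmod a * \sum_(i < n) cmod q ^+ i) <= _); last first.
  by rewrite ler_expR ler_wpM2l ?cmod_ge0 ?geo_sum_le.
elim: n => [|n IH]; first by rewrite qpoch0 big_ord0 mulr0 expR0 cmod1.
rewrite qpochS cmodM big_ord_recr mulrDr expRD; apply: ler_pM; rewrite ?cmod_ge0//.
apply: le_trans (ler_cmodB _ _) _; rewrite cmod1 cmodM cmodX.
exact: expR_ge1Dx.
Qed.

Lemma cvg_qpoch a : (qpoch a q n @[n --> \oo] --> (qpoch_inf a q : C))%classic.
Proof.
(* The increments of the partial products: they telescope, and they are dominated by a geometric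
   series. *)
pose d (k : nat) := - (qpoch a q k * (a * q ^+ k)).
have sd : abs_summable d.
  have := abs_summableZ ((qpoch_bound a * cmod a)%:C%C) (abs_summable_expn q1).
  apply: abs_summable_le => k; rewrite cmodN !cmodM mulrA ler_wpM2r ?cmod_ge0//.
  rewrite [leRHS](_ : _ = qpoch_bound a * cmod a).
    by rewrite ler_wpM2r ?cmod_ge0// ler_qpoch_bound.
  by rewrite cmod_real// mulr_ge0 ?cmod_ge0// ltW// qpoch_bound_gt0.
have dE n : \sum_(i <- [fset i in iota 0 n]%fset) d i = qpoch a q n - 1.
  rewrite sum_fset_seq ?iota_uniq//.
  elim: n => [|n IH]; first by rewrite qpoch0 subrr big_nil.
  rewrite -addn1 iotaD big_cat/= IH big_seq1 addn1 qpochS /d add0n; ring.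
suff h : (qpoch a q n @[n --> \oo] --> ((usum predT d + 1) : C))%classic.
  by rewrite /qpoch_inf (num_cvg_lim _ h).
apply/cvgC_cmodP => e /(abs_summable_has_sum sd)[A hA].
exists (\max_(i <- A) i).+1 => // n /= hn.
rewrite (_ : usum predT d + 1 - qpoch a q n = usum predT d - (qpoch a q n - 1)); last by ring.
rewrite -dE; apply: hA; apply/fsubsetP => i iA; rewrite inE /= mem_iota/= add0n.
by apply: leq_trans hn; rewrite ltnS; apply: leq_bigmax_seq iA _.
Qed.

(** A bound uniform in [n] survives the limit, so an infinite product without zero factors is
    nonzero. It also bounds the denominators of the Gaussian binomials. *)
Lemma qpoch_lower_bound a : (forall k : nat, 1 - a * q ^+ k != 0) ->
  exists2 d : R, 0 < d & forall n, d <= cmod (qpoch a q n).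
Proof.
move=> ha; pose s := (1 - cmod q)^-1.
have s0 : 0 < s by rewrite invr_gt0 subr_gt0.
(* By [(1 - v) * (1 - u) >= 1 - (v + u)], the modulus of the product is at least one minus the
   geometric sum of the [|b q^i|]. *)
have small b n : cmod b * s <= 1 / 2 -> 1 / 2 <= cmod (qpoch b q n).
  move=> hb; apply: le_trans (_ : 1 - cmod b * \sum_(i < n) cmod q ^+ i <= _).
    have : cmod b * \sum_(i < n) cmod q ^+ i <= cmod b * s.
      by rewrite ler_wpM2l ?cmod_ge0 ?geo_sum_le.
    by lra.
  elim: n => [|n IH]; first by rewrite big_ord0 qpoch0 cmod1 mulr0 subr0.
  rewrite qpochS cmodM big_ord_recr/=.
  set S := \sum_(i < n) _ in IH *.
  have S0 : 0 <= S by apply: sumr_ge0 => i _; rewrite exprn_ge0 ?cmod_ge0.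
  have hS : cmod b * (S + cmod q ^+ n) <= cmod b * s.
    have := geo_sum_le n.+1; rewrite big_ord_recr/= => h.
    by rewrite ler_wpM2l ?cmod_ge0.
  have u0 : 0 <= cmod b * cmod q ^+ n by rewrite mulr_ge0 ?exprn_ge0 ?cmod_ge0.
  have hu : 1 - cmod b * cmod q ^+ n <= cmod (1 - b * q ^+ n).
    have := ler_cmodD (1 - b * q ^+ n) (b * q ^+ n).
    by rewrite subrK cmod1 [in X in _ <= _ + X]cmodM cmodX; lra.
  have bS0 : 0 <= cmod b * S by rewrite mulr_ge0 ?cmod_ge0.
  rewrite mulrDr in hS *.
  set u := cmod b * cmod q ^+ n in hS u0 hu *; set v := cmod b * S in hS bS0 IH *.
  apply: le_trans (_ : (1 - v) * (1 - u) <= _); first by nra.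
  by apply: ler_pM => //; lra.
(* Past the first [M] factors the parameter [a q^M] is small enough for [small]. *)
have [M hM] : exists M, cmod (a * q ^+ M) * s <= 1 / 2.
  have as0 : 0 < cmod a * s + 1 by rewrite ltr_wpDl// mulr_ge0 ?cmod_ge0 ?ltW.
  have e0 : 0 < 1 / 2 / (cmod a * s + 1) by rewrite divr_gt0.
  have /cvgrPdist_le h : (cmod q ^+ n @[n --> \oo] --> (0 : R))%classic.
    by apply: cvg_expr; rewrite ger0_norm ?cmod_ge0.
  have [M _ hM] := h _ e0; exists M; have := hM M (leqnn _).
  rewrite sub0r normrN ger0_norm ?exprn_ge0 ?cmod_ge0//.
  rewrite (ler_pdivlMr _ _ as0) cmodM cmodX.
  have : 0 <= cmod q ^+ M by rewrite exprn_ge0 ?cmod_ge0.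
  by nra.
have p0 : 0 < cmod (qpoch a q M) by rewrite cmod_gt0 qpoch_neq0.
have B0 := qpoch_bound_gt0 a.
(* The divisor covers two cases: for [n >= M] the factors after the first [M] cost at most a factor
   2, and for [n < M] the factors from [n] to [M] are at most [qpoch_bound a] in modulus. *)
exists (cmod (qpoch a q M) / (2 + qpoch_bound a)).
  by rewrite divr_gt0// addr_gt0.
move=> n; rewrite ler_pdivrMr ?addr_gt0//.
have [Mn|nM] := leqP M n.
  have := small _ (n - M)%N hM; rewrite -{2}(subnKC Mn) qpochD cmodM => h.
  rewrite -mulrA ler_peMr ?ltW//.
  by set X := cmod _ in h *; nra.
rewrite -(subnKC (ltnW nM)) qpochD cmodM ler_wpM2l ?cmod_ge0//.
apply: le_trans (ler_qpoch_bound _ _) _.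
apply: le_trans (_ : qpoch_bound a <= _); last by lra.
rewrite /qpoch_bound ler_expR ler_wpM2r ?(ltW s0)// cmodM cmodX.
by rewrite ler_piMr ?cmod_ge0// exprn_ile1 ?cmod_ge0 ?ltW.
Qed.

Lemma qpoch_inf_neq0 a : (forall k : nat, 1 - a * q ^+ k != 0) -> qpoch_inf a q != 0.
Proof.
move=> /qpoch_lower_bound[d d0 hd]; rewrite -cmod_gt0.
have d2 : 0 < d / 2 by rewrite divr_gt0.
have /cvgC_cmodP/(_ _ d2)[N _ hN] := @cvg_qpoch a.
have := hN N (leqnn _); have := hd N.
have := ler_cmodD (qpoch_inf a q) (qpoch a q N - qpoch_inf a q).
by rewrite [X in cmod X]addrC subrK (cmodBC _ (qpoch_inf a q)); lra.
Qed.

End QPochhammer.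

(** * Gaussian binomials and the finite q-binomial theorem *)

Section QBinomial.
Variables (K : fieldType) (q : K).

(** The Gaussian binomial coefficient, given by a q-Pascal rule so that no division occurs. *)
Fixpoint qbinom (n m : nat) : K :=
  match n, m with
  | _, 0 => 1
  | 0, _.+1 => 0
  | n'.+1, m'.+1 => q ^+ m * qbinom n' m + qbinom n' m'
  end.

Lemma qbinomn0 n : qbinom n 0 = 1. Proof. by case: n. Qed.

Lemma qbinomS n m : qbinom n.+1 m.+1 = q ^+ m.+1 * qbinom n m.+1 + qbinom n m.
Proof. by []. Qed.

Lemma qbinom_small n m : (n < m)%N -> qbinom n m = 0.
Proof.
elim: n m => [|n IH] [|m]//; rewrite ltnS qbinomS => nm.
by rewrite !IH ?mulr0 ?addr0// ltnW.
Qed.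

(** Splitting off the factor [i = 0] replaces [z] by [z q] in the rest; comparing coefficients of
    powers of [z] is then the q-Pascal rule. *)
Lemma prod_qbinom n (z : K) :
  \prod_(i < n) (1 + z * q ^+ i) =
  \sum_(j < n.+1) qbinom n j * q ^+ 'C(j, 2) * z ^+ j.
Proof.
elim: n z => [|n IH] z; first by rewrite big_ord0 big_ord1/= !mulr1.
rewrite big_ord_recl expr0 mulr1.
under eq_bigr do rewrite exprS mulrA.
rewrite IH mulrDl mul1r {1}big_ord_recl /= !mulr1.
rewrite [RHS]big_ord_recl /= !mulr1 qbinomn0 -addrA; congr (_ + _).
have -> : \sum_(i < n) qbinom n (lift ord0 i) * q ^+ 'C(lift ord0 i, 2) *
     (z * q) ^+ lift ord0 i =
   \sum_(i < n.+1) qbinom n i.+1 * q ^+ 'C(i.+1, 2) * (z * q) ^+ i.+1.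
  by rewrite big_ord_recr/= (qbinom_small (ltnSn n)) !mul0r addr0.
rewrite mulr_sumr -big_split/=; apply: eq_bigr => i _.
rewrite /bump /= add1n add0n binS bin1 !exprMn !exprD !exprS; ring.
Qed.

End QBinomial.

(** * The Jacobi triple product as a limit of its finite form *)

Section TripleProduct.
Variables (R : realType) (q : R[i]).
Hypotheses (q0 : q != 0) (q1 : cmod q < 1).
Local Notation C := (R[i] : numFieldType).
Implicit Types (a x z : R[i]).

Let qk_neq1 (k : nat) : 1 - q * q ^+ k != 0.
Proof.
rewrite -exprS subr_eq0; apply/eqP => h; have := q1.
have : cmod q ^+ k.+1 = 1 by rewrite -cmodX -h cmod1.
move=> h1; rewrite ltNge => /negP; apply.
rewrite -h1 exprS ler_piMr ?cmod_ge0// exprn_ile1 ?cmod_ge0 ?ltW//.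
Qed.

(** The product formula, multiplied out. The induction rests on [1 - q^(n+1) = q^(m+1) (1 - q^(n-m))
    + (1 - q^(m+1))]. *)
Lemma qpoch_qbinom n m : (m <= n)%N ->
  qbinom q n m * (qpoch q q m * qpoch q q (n - m)) = qpoch q q n.
Proof.
elim: n m => [|n IH] [|m] //; rewrite ?qbinomn0 ?qpoch0 ?subn0 ?mul1r// ltnS => mn.
rewrite qbinomS mulrDl subSS qpochS -!exprS.
have -> : qbinom q n m * (qpoch q q m * (1 - q ^+ m.+1) * qpoch q q (n - m)) =
  qpoch q q n * (1 - q ^+ m.+1) by rewrite -(IH m)//; ring.
move: mn; rewrite leq_eqVlt => /orP[/eqP->|mn].
  by rewrite qbinom_small// mulr0 mul0r add0r qpochS exprS.
rewrite -(subnSK mn) qpochS.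
have := IH _ mn; rewrite qpochS -exprS => h.
rewrite (_ : _ * _ * _ = q ^+ m.+1 * (1 - q * q ^+ (n - m.+1)) * qpoch q q n); last first.
  by rewrite -h; ring.
rewrite qpochS mulrBr mulr1 !mulrA -exprSr -exprD.
have -> : (m.+2 + (n - m.+1) = n.+1)%N by lia.
by rewrite -exprS; ring.
Qed.

Definition theta_term x (n : int) : R[i] := (-1) ^ n * q ^ binz2 n * x ^ n.

Lemma abs_summable_theta x : x != 0 -> abs_summable (theta_term x).
Proof.
move=> x0; have [L hL] := ler_cmod_expz_of_le q0 q1 x0.
(* The constant exceeds what the quadratic exponent lacks against [(L + 1) |n|] near the origin. *)
apply: (abs_summable_majorant q0 (c := ((2 * L + 3) * (2 * L + 3))%N) (abs_summable_expz q1)) => n.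
rewrite /theta_term !cmodM !cmodXz cmodN cmod1 exp1rz mul1r.
apply: le_trans (ler_wpM2l _ (hL n)) _; first by rewrite exprz_ge0 ?cmod_ge0.
rewrite -expfzDr ?cmod_eq0//; apply: ler_cmod_expz => //.
move: (binz2 n) (binz2_double n) => b; case: n {hL} => n /=; nia.
Qed.

(** Each factor is reflected by [1 - x q^(-k) = - x q^(-k) (1 - q^k / x)] for [k = 1, ..., n]. *)
Lemma qpoch_flip x n : x != 0 ->
  qpoch (x * q ^ (- n%:Z)) q n =
  (-1) ^ n%:Z * x ^ n%:Z * q ^ (- 'C(n.+1, 2)%:Z) * qpoch (q / x) q n.
Proof.
move=> x0; elim: n => [|n IH]; first by rewrite !qpoch0 !mulr1.
rewrite -{2}[n.+1]add1n qpochD qpochS qpoch0 mul1r expr0 mulr1 expr1.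
have -> : x * q ^ (- n.+1%:Z) * q = x * q ^ (- n%:Z).
  by rewrite -mulrA -{2}[q]expr1z -expfzDr//; congr (_ * _ ^ _); lia.
rewrite IH qpochS.
have -> : (- 'C(n.+2, 2)%:Z) = - 'C(n.+1, 2)%:Z - n.+1%:Z.
  by rewrite binS bin1; lia.
rewrite expfzDr// -[n.+1%:Z]/(1 + n)%:Z PoszD !expfzDr// !expr1z.
rewrite -PoszD add1n -exprnN exprS -exprnP.
by field; rewrite x0 q0 expf_neq0.
Qed.

Lemma qpochE a n : qpoch a q n = \prod_(i < n) (1 - a * q ^+ i).
Proof. by elim: n => [|n IH]; rewrite ?qpoch0 ?big_ord0// qpochS big_ord_recr IH. Qed.

(** The q-binomial theorem with [2 n] factors at [z = - x q^(-n)], reindexed by [l = n + j]. The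
    test [0 <= n + j] is there because the absolute value would fold negative indices back; indices
    above [2 n] vanish through [qbinom_small]. *)
Lemma triple_product_finite x n : x != 0 ->
  has_sum (fun j : int => if 0 <= n%:Z + j
                          then qbinom q (n + n) `|n%:Z + j| * theta_term x j else 0)
    (qpoch x q n * qpoch (q / x) q n).
Proof.
move=> x0; set F := (fun j : int => _).
have [s sE] : exists s : seq int, s = [seq l%:Z - n%:Z | l <- iota 0 (n + n).+1] by eexists.
pose A : {fset int} := [fset j in s]%fset.
have FA (j : int) : j \notin A -> F j = 0.
  rewrite /F; case: ifP => // nj jA; rewrite qbinom_small ?mul0r// ltnNge.
  apply: contra jA => h.
  rewrite inE sE; apply/mapP; exists (absz (n%:Z + j)); [rewrite mem_iota; lia|lia].
suff -> : qpoch x q n * qpoch (q / x) q n = \sum_(i <- A) F i by exact: has_sum_finite.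
rewrite sum_fset_seq sE; last first.
  by rewrite map_inj_uniq ?iota_uniq// => i j /= ?; lia.
rewrite big_map.
have N0 : (-1 : R[i]) != 0 by rewrite oppr_eq0 oner_eq0.
have := prod_qbinom q (n + n) (- (x * q ^ (- n%:Z))).
rewrite (_ : \prod_(i < n + n) _ = qpoch (x * q ^ (- n%:Z)) q (n + n)); last first.
  by rewrite qpochE; apply: eq_bigr => i _; rewrite mulNr.
rewrite qpochD qpoch_flip//.
rewrite (_ : x * q ^ (- n%:Z) * q ^+ n = x); last first.
  by rewrite -mulrA [q ^+ n]exprnP -expfzDr// addNr mulr1.
set c := (-1) ^ n%:Z * _ * _ => h.
have c0 : c != 0 by rewrite !mulf_neq0 ?expfz_neq0.
have -> : qpoch x q n * qpoch (q / x) q n = c^-1 * (c * qpoch (q / x) q n * qpoch x q n).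
  by rewrite -mulrA mulKf// mulrC.
rewrite h mulr_sumr -[LHS](big_mkord xpredT (fun l => c^-1 *
  (qbinom q (n + n) l * q ^+ 'C(l, 2) * (- (x * q ^ (- n%:Z))) ^+ l))) /index_iota subn0.
apply: eq_big_seq => l _; rewrite /F (addrC n%:Z) subrK.
rewrite lez_nat /= /theta_term /c !exprnP !invfM.
rewrite -[- (x * _)]mulN1r !expfzMl !invr_expz !exprz_exp opprK.
rewrite (addrC (l : int)).
rewrite !expfzDr//.
have -> : binz2 (- n%:Z + l) = 'C(n.+1, 2)%:Z + 'C(l, 2)%:Z + - n%:Z * l.
  have := binz2_double (- n%:Z + l); have := binz2_double l.
  by have := binz2_double n.+1; rewrite !binz2_nat; nia.
by rewrite !expfzDr//; ring.
Qed.

Lemma cvg_qpoch_comp a (h : nat -> nat) : (forall M, \forall n \near \oo%classic, (M <= h n)%N) ->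
  (qpoch a q (h n) @[n --> \oo] --> (qpoch_inf a q : C))%classic.
Proof.
move=> hh; apply/cvgC_cmodP => e e0.
have /cvgC_cmodP/(_ _ e0)[N _ hN] := @cvg_qpoch _ q q1 a.
by apply: filterS (hh N) => n hn; exact: hN.
Qed.

(** As [n] grows, the coefficient [qbinom q (2 n) (n + j)] tends to [1 / (q)_oo] and stays bounded,
    so the finite form passes to the limit by dominated convergence. *)
Lemma ThetaE x : x != 0 -> Theta x q = usum predT (theta_term x).
Proof.
move=> x0; pose P := qpoch_inf q q.
have P0 : P != 0 by exact: qpoch_inf_neq0.
have [d d0 hd] := qpoch_lower_bound q1 qk_neq1.
(* Bounds every [qbinom q n m] with [m <= n]: numerator at most [qpoch_bound q q], both denominators
   at least [d]. *)
pose B := qpoch_bound q q / (d * d).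
have B0 : 0 <= B by rewrite divr_ge0 ?mulr_ge0 ?ltW// qpoch_bound_gt0.
pose f n (j : int) := if 0 <= n%:Z + j
   then qbinom q (n + n) `|n%:Z + j| * theta_term x j else 0.
(* The sum of the two constants dominates both the finite coefficients and the limit coefficient. *)
pose G (j : int) := (B + cmod P^-1)%:C%C * theta_term x j.
have qb n m : (m <= n)%N -> qbinom q n m = qpoch q q n / (qpoch q q m * qpoch q q (n - m)).
  by move=> /qpoch_qbinom <-; rewrite mulfK// mulf_neq0// qpoch_neq0.
suff h : (qpoch x q n * qpoch (q / x) q n @[n --> \oo] -->
    (P^-1 * usum predT (theta_term x) : C))%classic.
  have h' : (qpoch x q n * qpoch (q / x) q n @[n --> \oo] -->
      (qpoch_inf x q * qpoch_inf (q / x) q : C))%classic.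
    by apply: (@cvgM C); exact: cvg_qpoch.
  rewrite /Theta -(num_cvg_lim _ h') (num_cvg_lim _ h) -/P.
  by rewrite mulrAC mulVf// mul1r.
have sth := abs_summable_theta x0.
have cG : cmod (B + cmod P^-1)%:C%C = B + cmod P^-1.
  by rewrite cmod_real// addr_ge0 ?cmod_ge0.
have sG : abs_summable G by exact: abs_summableZ.
have hf n : has_sum (f n) (qpoch x q n * qpoch (q / x) q n).
  exact: triple_product_finite.
have hg := has_sumZ P^-1 (abs_summable_has_sum sth).
apply: (@has_sum_dominated_cvg R _ nat (\oo)%classic _ f _ G _ _ sG _ _ _ hf hg).
- move=> n /= j; rewrite /f /G; case: ifP => nj; last by rewrite cmod0 cmod_ge0.
  rewrite [leLHS]cmodM [leRHS]cmodM cG ler_wpM2r ?cmod_ge0//.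
  have [le|lt] := leqP (absz (n%:Z + j)) (n + n); last first.
    by rewrite qbinom_small// cmod0 addr_ge0 ?cmod_ge0.
  rewrite qb// cmodM cmodV cmodM; apply: le_trans (_ : B <= _); last first.
    by rewrite lerDl cmod_ge0.
  apply: ler_pM; rewrite ?cmod_ge0 ?invr_ge0 ?mulr_ge0 ?cmod_ge0 ?ler_qpoch_bound//.
  rewrite lef_pV2 ?posrE ?mulr_gt0//; first by rewrite ler_pM// ltW.
    by rewrite (lt_le_trans d0).
  by rewrite (lt_le_trans d0).
- move=> j; rewrite /G [leLHS]cmodM [leRHS]cmodM cG ler_wpM2r ?cmod_ge0//.
  by rewrite lerDr.
move=> j.
(* This quotient equals the coefficient in [f n j] as soon as [n >= |j|]. *)
have h : (qpoch q q (n + n) / (qpoch q q (absz (n%:Z + j)) * qpoch q q (absz (n%:Z - j)))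
    * theta_term x j @[n --> \oo] --> (P / (P * P) * theta_term x j : C))%classic.
  apply: (@cvgM C); last exact: (@cvg_cst C).
  apply: (@cvgM C).
    by apply: cvg_qpoch_comp => M; exists M => // n /= ?; lia.
  apply: (@cvgV C); first by rewrite mulf_neq0.
  by apply: (@cvgM C); apply: cvg_qpoch_comp => M;
    exists (M + `|j|)%N => // n /= ?; lia.
rewrite (_ : P^-1 = P / (P * P)); last by rewrite invfM mulrA mulfV// mul1r.
move/cvgC_cmodP: h => h; apply/cvgC_cmodP => e /h.
apply: filterS2 (_ : \forall n \near \oo%classic, (`|j| <= n)%N); last by exists `|j|%N.
move=> n nj hn; rewrite /f ifT; last by lia.
rewrite qb; last by lia.
by rewrite (_ : (n + n - _)%N = absz (n%:Z - j)); last by lia.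
Qed.

End TripleProduct.

(** * Hecke-type double sums *)

Section HeckeSums.
Variables (R : realType).
Local Notation C := R[i].

Lemma abs_summable_finite (I : choiceType) (F : I -> C) (A : {fset I}) :
  (forall i, i \notin A -> F i = 0) -> abs_summable F.
Proof.
move=> F0; exists (\sum_(i <- A) cmod (F i)) => B.
apply: le_trans (_ : \sum_(i <- (A `|` B)%fset) cmod (F i) <= _).
  by rewrite (fsum_split _ (fsubsetUr A B)) lerDl sumr_ge0// => i _; exact: cmod_ge0.
rewrite (fsum_split _ (fsubsetUl A B)) gerDl big_seq big1// => i.
by rewrite !inE => /andP[/F0 -> _]; rewrite cmod0.
Qed.

Definition delta (I : choiceType) (i0 i : I) : C := (i == i0)%:R.

Lemma delta_neq (I : choiceType) (i0 i : I) : i \notin [fset i0]%fset -> delta i0 i = 0.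
Proof. by rewrite inE /delta => /negbTE ->. Qed.

Lemma abs_summable_delta (I : choiceType) (i0 : I) : abs_summable (delta i0).
Proof. exact/abs_summable_finite/delta_neq. Qed.

Lemma usum_delta (I : choiceType) (i0 : I) (c : C) :
  usum predT (fun i => c * delta i0 i) = c.
Proof.
rewrite (usum_has_sum (has_sumZ c (has_sum_finite (@delta_neq _ i0)))).
by rewrite big_seq_fset1 /delta eqxx mulr1.
Qed.

(** Places a single sum on the line [p.2 = j0] of a double sum, the form in which boundary terms
    enter later. *)
Lemma has_sum_delta_r (I J : choiceType) (g : I -> C) (j0 : J) : abs_summable g ->
  has_sum (fun p : I * J => g p.1 * delta j0 p.2) (usum predT g).
Proof.
move=> sg; have sG := abs_summableM sg (abs_summable_delta j0).
have := abs_summable_has_sum sG.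
rewrite -(usum_has_sum (has_sum_rows sG)) /=.
by under [X in usum _ X]eq_fun do rewrite usum_delta.
Qed.

Lemma has_sum_delta_l (I J : choiceType) (g : J -> C) (i0 : I) : abs_summable g ->
  has_sum (fun p : I * J => g p.2 * delta i0 p.1) (usum predT g).
Proof.
move=> sg; pose sw (p : I * J) := (p.2, p.1); pose sw' (p : J * I) := (p.2, p.1).
have swK : cancel sw sw' by case. have sw'K : cancel sw' sw by case.
exact: (has_sum_reindex swK sw'K (has_sum_delta_r i0 sg)).
Qed.

Lemma N1_neq0 : (-1 : C) != 0. Proof. by rewrite oppr_eq0 oner_eq0. Qed.

Lemma signzD (a b : int) : (-1) ^ (a + b) = (-1) ^ a * (-1) ^ b :> C.
Proof. by rewrite expfzDr// N1_neq0. Qed.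

Lemma signz_double (a : int) : (-1) ^ (2 * a) = 1 :> C.
Proof. by rewrite -exprz_exp -[(-1) ^ 2]/((-1) ^+ 2) sqrrN expr1n exp1rz. Qed.

Lemma signz_parity (a b c : int) : a - b = 2 * c -> (-1) ^ a = (-1) ^ b :> C.
Proof. by move=> h; rewrite -[a](subrK b) h signzD signz_double mul1r. Qed.

Lemma signzS (a : int) : (-1) ^ (1 + a) = - (-1) ^ a :> C.
Proof. by rewrite signzD -[(-1) ^ 1]/(-1) mulN1r. Qed.

Lemma cmod_signz (a : int) : cmod ((-1) ^ a : C) = 1.
Proof. by rewrite cmodXz cmodN cmod1 exp1rz. Qed.

(** In this form a shift of one index changes one indicator only, hence produces one boundary
    line. *)
Lemma sg2E (r s : int) : sg2 C r s = (0 <= r)%R%:R + (0 <= s)%R%:R - 1.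
Proof.
have h2 : (2 : C) != 0 by rewrite pnatr_eq0.
by rewrite /sg2 /sg1; case: (0 <= r); case: (0 <= s) => /=; field.
Qed.

Lemma sg2_neq0 (r s : int) : sg2 C r s != 0 -> (0 <= r) = (0 <= s).
Proof.
rewrite sg2E; case: (0 <= r); case: (0 <= s) => //=; last first.
  by rewrite add0r subrr eqxx.
by rewrite addr0 subrr eqxx.
Qed.

Lemma cmod_sg2_le (r s : int) : cmod (sg2 C r s) <= 1.
Proof.
rewrite sg2E; case: (0 <= r); case: (0 <= s) => /=;
  by rewrite ?addrK ?addr0 ?add0r ?subrr ?cmodN ?cmod1 ?cmod0.
Qed.

Variable q : C.
Hypotheses (q0 : q != 0) (q1 : cmod q < 1).

(* The substitution k -> 1 - 2 n - k changes the sign of every term. *)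
Lemma usum_theta_term_expz (n : int) : usum predT (theta_term q (q ^ n)) = 0.
Proof.
have sT := abs_summable_theta q0 q1 (expfz_neq0 n q0).
pose h (k : int) := 1 - 2 * n - k.
have hK : cancel h h by move=> k; rewrite /h; ring.
have := has_sum_reindex hK hK (abs_summable_has_sum sT).
have thetaE k : theta_term q (q ^ n) k = (-1) ^ k * q ^ (binz2 k + n * k).
  by rewrite /theta_term exprz_exp -mulrA -expfzDr.
have -> : (fun k => theta_term q (q ^ n) (h k)) = (fun k => -1 * theta_term q (q ^ n) k).
  apply/funext => k; rewrite (thetaE (h k)) (thetaE k) mulN1r -mulNr.
  congr (_ * _ ^ _).
    by rewrite -signzS; apply: (@signz_parity _ _ (- n - k)); rewrite /h; ring.
  have := binz2_double (h k); have := binz2_double k; rewrite /h; nia.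
move=> /has_sum_unique/(_ (has_sumZ (-1) (abs_summable_has_sum sT))).
rewrite mulN1r => /eqP; rewrite -addr_eq0 -mulr2n mulrn_eq0 /=.
by move/eqP.
Qed.

Definition hecke_term (a b c : int) (x y : C) (p : int * int) : C :=
  (-1) ^ (p.1 + p.2) * x ^ p.1 * y ^ p.2 *
  q ^ (a * binz2 p.1 + b * p.1 * p.2 + c * binz2 p.2).

Lemma heckeE a b c x y : hecke a b c x y q =
  usum predT (fun p => sg2 C p.1 p.2 * hecke_term a b c x y p).
Proof.
by rewrite /hecke; congr usum; apply/funext => -[r s]; rewrite /hecke_term !mulrA.
Qed.

(** Where the sign is nonzero, [r] and [s] lie on the same side of 0, so [b r s >= 0] and the two
    remaining quadratics beat all linear terms. *)
Lemma abs_summable_hecke (a b c : int) (x y : C) :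
  1 <= a -> 0 <= b -> 1 <= c -> x != 0 -> y != 0 ->
  abs_summable (fun p => sg2 C p.1 p.2 * hecke_term a b c x y p).
Proof.
move=> a1 b0 c1 x0 y0.
have [L hL] := ler_cmod_expz_of_le q0 q1 x0.
have [M hM] := ler_cmod_expz_of_le q0 q1 y0.
apply: (abs_summable_majorant q0
  (c := ((2 * L + 3) * (2 * L + 3) + (2 * M + 3) * (2 * M + 3))%N)
  (abs_summable_weight2 q1)) => -[r s].
rewrite /hecke_term /weight2 /=.
have [->|/sg2_neq0 rs] := eqVneq (sg2 C r s) 0.
  by rewrite mul0r cmod0 exprz_ge0 ?cmod_ge0.
apply: le_trans (_ : cmod q ^ (- (L%:Z * `|r|)) * cmod q ^ (- (M%:Z * `|s|)) *
    cmod q ^ (a * binz2 r + b * r * s + c * binz2 s) <= _).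
  rewrite cmodM -[leRHS]mul1r; apply: ler_pM; rewrite ?cmod_ge0 ?cmod_sg2_le//.
  rewrite 3!cmodM cmod_signz mul1r !cmodXz ler_wpM2r ?exprz_ge0 ?cmod_ge0//.
  by apply: ler_pM; rewrite ?exprz_ge0 ?cmod_ge0.
rewrite -!expfzDr ?cmod_eq0//; apply: ler_cmod_expz => //.
have rs0 : 0 <= b * (r * s) by apply: mulr_ge0 => //; nia.
have h1 := binz2_double r; have h2 := binz2_double s.
have B1 : 0 <= binz2 r by nia.
have B2 : 0 <= binz2 s by nia.
have h3 : binz2 r <= a * binz2 r by nia.
have h4 : binz2 s <= c * binz2 s by nia.
rewrite -[b * r * s]mulrA.
move: (binz2 r) (binz2 s) h1 h2 B1 B2 h3 h4 => B B' h1 h2 B1 B2 h3 h4.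
have k1 : `|r| + L%:Z * `|r| - ((2 * L + 3) * (2 * L + 3))%N%:Z <= B.
  by clear -h1; case: r h1 => r /=; nia.
have k2 : `|s| + M%:Z * `|s| - ((2 * M + 3) * (2 * M + 3))%N%:Z <= B'.
  by clear -h2; case: s h2 => s /=; nia.
lia.
Qed.

Lemma hecke_sym a b c x y : 1 <= a -> 0 <= b -> 1 <= c -> x != 0 -> y != 0 ->
  hecke a b c x y q = hecke c b a y x q.
Proof.
move=> a1 b0 c1 x0 y0; rewrite !heckeE; apply: usum_has_sum.
pose sw (p : int * int) := (p.2, p.1); have swK : cancel sw sw by case.
have := has_sum_reindex swK swK
  (abs_summable_has_sum (abs_summable_hecke c1 b0 a1 y0 x0)).
congr has_sum; apply/funext => -[r s]; rewrite /hecke_term /sw /= !sg2E.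
rewrite [s + r]addrC [(0 <= s)%R%:R + _]addrC.
rewrite (_ : c * binz2 s + b * s * r + a * binz2 r =
  a * binz2 r + b * r * s + c * binz2 s); last by ring.
by ring.
Qed.

(** The summand at [(r, s)] is [- y] times the one at [(r, s - 1)] for the shifted arguments. The
    signs differ only on [s = 0], whose terms form a theta series in base [q^a]; the index [-1] in
    the delta is [s - 1] there. *)
Lemma hecke_shift a b c x y : 1 <= a -> 0 <= b -> 1 <= c -> x != 0 -> y != 0 ->
  hecke a b c x y q = - y * hecke a b c (x * q ^ b) (y * q ^ c) q +
    usum predT (theta_term (q ^ a) x).
Proof.
move=> a1 b0 c1 x0 y0; rewrite [in LHS]heckeE; apply: usum_has_sum.
have x1 : x * q ^ b != 0 by rewrite mulf_neq0 ?expfz_neq0.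
have y1 : y * q ^ c != 0 by rewrite mulf_neq0 ?expfz_neq0.
have qa1 : cmod (q ^ a) < 1.
  apply: le_lt_trans (q1); rewrite cmodXz -[leRHS]expr1z.
  exact: ler_cmod_expz.
pose sh (p : int * int) := (p.1, p.2 - 1); pose sh' (p : int * int) := (p.1, p.2 + 1).
have shK : cancel sh sh' by case=> r s; rewrite /sh /sh' /= subrK.
have shK' : cancel sh' sh by case=> r s; rewrite /sh /sh' /= addrK.
have sT := abs_summable_theta (expfz_neq0 a q0) qa1 x0.
have := has_sum_reindex shK shK' (has_sumD (has_sumZ (- y)
  (abs_summable_has_sum (abs_summable_hecke a1 b0 c1 x1 y1)))
  (has_sum_delta_r (-1 : int) sT)).
rewrite -heckeE; congr has_sum; apply/funext => -[r s]; rewrite /sh /=.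
have -> : - y * (sg2 C r (s - 1) * hecke_term a b c (x * q ^ b) (y * q ^ c) (r, s - 1)) =
   sg2 C r (s - 1) * hecke_term a b c x y (r, s).
  rewrite /hecke_term /= !expfzMl !exprz_exp.
  have -> : (-1) ^ (r + (s - 1)) = - (-1) ^ (r + s) :> C.
    by rewrite -signzS; apply: (@signz_parity _ _ (-1)); ring.
  have ys : y * y ^ (s - 1) = y ^ s by rewrite -{1}[y]expr1z -expfzDr// addrC subrK.
  have qs : q ^ (b * r) * q ^ (c * (s - 1)) *
      q ^ (a * binz2 r + b * r * (s - 1) + c * binz2 (s - 1)) =
      q ^ (a * binz2 r + b * r * s + c * binz2 s).
    rewrite -!expfzDr//; congr (_ ^ _).
    have -> : binz2 s = binz2 (s - 1) + (s - 1).
      by have := binz2_double s; have := binz2_double (s - 1); nia.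
    by ring.
  by rewrite -qs -ys; ring.
rewrite !sg2E /delta.
have [->|s0] := eqVneq s 0.
  rewrite sub0r eqxx /hecke_term /theta_term /= !mulr0 !addr0 expr0z mulr1 mulr1.
  by rewrite exprz_exp; ring.
have -> : (s - 1 == -1) = false by lia.
have -> : (0 <= s - 1) = (0 <= s) by lia.
by rewrite mulr0 addr0.
Qed.

End HeckeSums.

(** * The fourfold sum *)

Section FourfoldSum.
Variables (R : realType) (q : R[i]) (t m : int).
Hypotheses (q0 : q != 0) (q1 : cmod q < 1) (t1 : 1 <= t).
Local Notation C := R[i].

Definition knum (r s : int) : C :=
  (-1) ^ (r + s) *
  q ^ (2 * binz2 r + 2 * t * r * s + binz2 s + 2 * (t + 1) * r + 2 * m * s).

Definition theta_coef (n : int) : C := (-1) ^ n * q ^ (n * (n - 1)).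

(* Picks the sum over j >= 0 when N <= 0 and minus the sum over j < 0 when N >= 1. *)
Definition gate (N j : int) : C := (0 <= j)%R%:R - (1 <= N)%R%:R.

(** A term of [y T(y)] times the geometric series in [y q^(2 r)]: the power [j] of the latter meets
    the theta coefficient of index [N - 1 - j] to give [y^N]. *)
Definition strip (y : C) (r N j : int) : C :=
  y ^ N * q ^ (2 * r * j) * theta_coef (N - 1 - j).

Definition fourfold (y : C) (p : (int * int) * (int * int)) : C :=
  sg2 C p.1.1 p.1.2 * knum p.1.1 p.1.2 *
  (gate p.2.1 p.2.2 * strip y p.1.1 p.2.1 p.2.2).

Lemma gate_neq0 (N j : int) : gate N j != 0 -> (0 <= j) = ~~ (1 <= N).
Proof.
rewrite /gate; case: (0 <= j); case: (1 <= N) => //=.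
  by rewrite subrr eqxx.
by rewrite subrr eqxx.
Qed.

Lemma cmod_gate_le (N j : int) : cmod (gate N j) <= 1.
Proof.
rewrite /gate; case: (0 <= j); case: (1 <= N) => /=;
  by rewrite ?subrr ?subr0 ?add0r ?sub0r ?cmodN ?cmod1 ?cmod0.
Qed.

(* The hypotheses cut out four cones. On the two where r and j have opposite signs the
   square (r + j)^2 vanishes along r = -j, where the linear terms still grow. *)
Lemma fourfold_exponent (L : nat) (r s N j : int) :
  (0 <= r) = (0 <= s) -> (0 <= j) = ~~ (1 <= N) ->
  (`|r| + `|s|)%N%:Z + (`|N| + `|j|)%N%:Z -
    (100 + (4 * `|m| + 8) * (4 * `|m| + 8) + (L + 8) * (L + 8))%N%:Z <=
  (2 * binz2 r + 2 * t * r * s + binz2 s + 2 * (t + 1) * r + 2 * m * s) +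
  2 * r * j + (N - 1 - j) * (N - 1 - j - 1) - L%:Z * `|N|.
Proof.
move=> rs jN; have hr := binz2_double r; have hs := binz2_double s.
move: (binz2 r) (binz2 s) hr hs => Br Bs hr hs.
(* Twice the part of the exponent depending on [s] alone, bounded below by completing the square in
   [|s|]. *)
have s_bound : 2 * `|s| <= s * s - s + 4 * m * s + (4 * `|m| + 8) * (4 * `|m| + 8).
  have h (x c : int) : - (c * c) <= x * x - c * x.
    by have := sqr_ge0 (2 * x - c); rewrite expr2; have := sqr_ge0 c; rewrite expr2; lia.
  have := h `|s| (3 + 4 * `|m|).
  have : - (`|m| * `|s|) <= m * s by rewrite -normrM; lia.
  have := normr_ge0 m; have : `|s| * `|s| = s * s by rewrite -normrM ger0_norm// -expr2 sqr_ge0.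
  by lia.
have N_bound : (2 * L%:Z + 12) * `|N| <= 2 * (N * N) + 2 * ((L + 8) * (L + 8))%N%:Z - 40.
  have := sqr_ge0 (2 * `|N| - (L%:Z + 6)); rewrite expr2.
  have : `|N| * `|N| = N * N by rewrite -normrM ger0_norm// -expr2 sqr_ge0.
  by lia.
rewrite !PoszD !abszE.
have [r0|r0] := lerP 0 r.
  have s0 : 0 <= s by lia.
  have trs : 0 <= t * r * s by rewrite !mulr_ge0 //; lia.
  have tr : 0 <= (t - 1) * r by rewrite mulr_ge0 //; lia.
  have [N1|N1] := lerP 1 N.
    have j0 : j < 0 by lia.
    have Nj : 0 <= (N - 1) * (- j) by rewrite mulr_ge0 //; lia.
    have := sqr_ge0 (r + j + 1); rewrite expr2; lia.
  have j0 : 0 <= j by lia.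
  have Nj : 0 <= (- N) * j by rewrite mulr_ge0 //; lia.
  have rj : 0 <= r * j by rewrite mulr_ge0 //; lia.
  have := sqr_ge0 r; rewrite expr2; have := sqr_ge0 j; rewrite expr2; lia.
have s0 : s < 0 by lia.
have trs : 0 <= t * (- r) * (- s - 1) by rewrite !mulr_ge0 //; lia.
have [N1|N1] := lerP 1 N.
  have j0 : j < 0 by lia.
  have Nj : 0 <= (N - 1) * (- j) by rewrite mulr_ge0 //; lia.
  have rj : 0 <= (- r) * (- j) by rewrite mulr_ge0 //; lia.
  have := sqr_ge0 (r + 1); rewrite expr2; have := sqr_ge0 (j + 1); rewrite expr2; lia.
have j0 : 0 <= j by lia.
have Nj : 0 <= (- N) * j by rewrite mulr_ge0 //; lia.
have := sqr_ge0 (r + j + 1); rewrite expr2; lia.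
Qed.

Lemma cmod_knum r s : cmod (knum r s) = cmod q ^
  (2 * binz2 r + 2 * t * r * s + binz2 s + 2 * (t + 1) * r + 2 * m * s).
Proof. by rewrite cmodM cmod_signz mul1r cmodXz. Qed.

Lemma cmod_strip y r N j : cmod (strip y r N j) =
  cmod y ^ N * cmod q ^ (2 * r * j + (N - 1 - j) * (N - 1 - j - 1)).
Proof.
by rewrite 3!cmodM cmod_signz mul1r !cmodXz -mulrA -expfzDr// cmod_eq0.
Qed.

Lemma abs_summable_fourfold y : y != 0 -> abs_summable (fourfold y).
Proof.
move=> y0; have [L hL] := ler_cmod_expz_of_le q0 q1 y0.
apply: (abs_summable_majorant q0
  (c := (100 + (4 * `|m| + 8) * (4 * `|m| + 8) + (L + 8) * (L + 8))%N)
  (abs_summable_weight4 q1)) => -[[r s] [N j]]; rewrite /fourfold /weight4 /weight2 /=.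
have [->|/sg2_neq0 rs] := eqVneq (sg2 C r s) 0.
  by rewrite !mul0r cmod0 exprz_ge0 ?cmod_ge0.
have [->|/gate_neq0 Nj] := eqVneq (gate N j) 0.
  by rewrite mul0r mulr0 cmod0 exprz_ge0 ?cmod_ge0.
apply: le_trans (ler_cmod_expz q0 q1 (fourfold_exponent L rs Nj)).
rewrite 3!cmodM cmod_knum cmod_strip.
set E := (2 * binz2 r + _ + _ + _ + _).
apply: le_trans (_ : 1 * cmod q ^ E * (1 * (cmod q ^ (- (L%:Z * `|N|)) *
   cmod q ^ (2 * r * j + (N - 1 - j) * (N - 1 - j - 1)))) <= _); last first.
  rewrite !mul1r -!expfzDr ?cmod_eq0//; apply: ler_cmod_expz => //.
  by rewrite -addrA; lia.
have ge0 e : 0 <= cmod q ^ e by rewrite exprz_ge0 ?cmod_ge0.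
have ge0y e : 0 <= cmod y ^ e by rewrite exprz_ge0 ?cmod_ge0.
apply: ler_pM; rewrite ?mulr_ge0 ?cmod_ge0//.
  by rewrite ler_wpM2r// cmod_sg2_le.
apply: ler_pM; rewrite ?mulr_ge0 ?cmod_ge0 ?cmod_gate_le//.
by rewrite ler_wpM2r.
Qed.

Lemma theta_termE (y : C) n : theta_term (q ^+ 2) y n = theta_coef n * y ^ n.
Proof.
by rewrite /theta_term /theta_coef (exprz_exp q 2) binz2_double.
Qed.

Lemma cmod_sqr_lt1 : cmod (q ^+ 2) < 1.
Proof. by rewrite cmodX exprn_ilt1 ?cmod_ge0. Qed.

Lemma sqr_neq0 : q ^+ 2 != 0. Proof. exact: expf_neq0. Qed.

Let T y := usum predT (theta_term (q ^+ 2) y).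

(** Up to a nonzero factor this is a row of the fourfold family: [s] is chosen on the same side of 0
    as [r], so that the sign does not vanish. *)
Lemma abs_summable_strip y r : y != 0 ->
  abs_summable (fun p => gate p.1 p.2 * strip y r p.1 p.2).
Proof.
move=> y0; pose s : int := if 0 <= r then 0 else -1.
pose c := sg2 C r s * knum r s.
have c0 : c != 0.
  apply: mulf_neq0; last by rewrite mulf_neq0 ?expfz_neq0 ?N1_neq0.
  rewrite sg2E /s.
  case: ifP => _ /=; first by rewrite addrK oner_eq0.
  by rewrite !add0r N1_neq0.
have := abs_summableZ c^-1 (abs_summable_row (abs_summable_fourfold y0) (r, s)).
apply: abs_summable_le => -[N j].
by rewrite /fourfold /= -/c mulKf.
Qed.

Lemma strip_step y r N j : y != 0 ->
  y * q ^ (2 * r) * strip y r (N - 1) (j - 1) = strip y r N j.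
Proof.
move=> y0; rewrite /strip (_ : N - 1 - 1 - (j - 1) = N - 1 - j); last by ring.
have -> : y ^ N = y * y ^ (N - 1) by rewrite -{2}[y]expr1z -expfzDr// addrC subrK.
have -> : q ^ (2 * r * j) = q ^ (2 * r) * q ^ (2 * r * (j - 1)).
  by rewrite -expfzDr//; congr (_ ^ _); ring.
by ring.
Qed.

(* Multiplication by y q^(2 r) shifts (N, j) by (1, 1), so 1 - y q^(2 r) times the sum
   telescopes to the lines j = 0 and N = 1; the latter is a vanishing theta value. *)
Lemma usum_strip (y : C) (r : int) : y != 0 -> 1 - y * q ^ (2 * r) != 0 ->
  usum predT (fun p => gate p.1 p.2 * strip y r p.1 p.2) =
  y * T y / (1 - y * q ^ (2 * r)).
Proof.
move=> y0 d0; have sS := abs_summable_strip r y0.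
set F := (fun p => _) in sS *; set S := usum predT F.
apply: (mulIf d0); rewrite divfK//.
pose sh (p : int * int) := (p.1 - 1, p.2 - 1).
pose sh' (p : int * int) := (p.1 + 1, p.2 + 1).
have shK : cancel sh sh' by case=> a b; rewrite /sh /sh' /= !subrK.
have shK' : cancel sh' sh by case=> a b; rewrite /sh /sh' /= !addrK.
have hS := abs_summable_has_sum sS.
have hS' := has_sumB hS (has_sumZ (y * q ^ (2 * r)) (has_sum_reindex shK shK' hS)).
pose g0 N := strip y r N 0; pose g1 j := strip y r 1 j.
have g0E N : g0 N = y * theta_term (q ^+ 2) y (N - 1).
  have yE : y * y ^ (N - 1) = y ^ N by rewrite -{1}[y]expr1z -expfzDr// addrC subrK.
  by rewrite theta_termE /g0 /strip mulr0 expr0z mulr1 subr0 -yE; ring.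
(* On the line [N = 1] only one factor [y] remains, and [j -> -j] turns the rest into the theta
   series at the power [(q^2)^(-r)] of its base. *)
have g1E j : g1 j = y * theta_term (q ^+ 2) ((q ^+ 2) ^ (- r)) (- j).
  have qE : ((q ^+ 2) ^ (- r)) ^ (- j) = q ^ (2 * r * j).
    by rewrite -[q ^+ 2]/(q ^ 2) !exprz_exp; congr (_ ^ _); ring.
  by rewrite theta_termE /g1 /strip expr1z subrr sub0r qE; ring.
have sub1K : cancel (fun N : int => N - 1) (fun N => N + 1) by move=> N; rewrite subrK.
have add1K : cancel (fun N : int => N + 1) (fun N => N - 1) by move=> N; rewrite addrK.
have Q0 : (q ^+ 2) ^ (- r) != 0 by rewrite expfz_neq0// sqr_neq0.
have sT := abs_summable_theta sqr_neq0 cmod_sqr_lt1 y0.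
have sT' := abs_summable_theta sqr_neq0 cmod_sqr_lt1 Q0.
have sg0 : abs_summable g0.
  rewrite (funext g0E); apply: abs_summableZ.
  exact: (abs_summable_reindex sub1K sT).
have sg1 : abs_summable g1.
  rewrite (funext g1E); apply: abs_summableZ.
  exact: (abs_summable_reindex (@opprK _) sT').
have ug0 : usum predT g0 = y * T y.
  apply: usum_has_sum; rewrite (funext g0E); apply: has_sumZ.
  exact: (has_sum_reindex sub1K add1K (abs_summable_has_sum sT)).
have ug1 : usum predT g1 = 0.
  rewrite (_ : 0 = y * usum predT (theta_term (q ^+ 2) ((q ^+ 2) ^ (- r)))); last first.
    by rewrite usum_theta_term_expz ?mulr0 ?sqr_neq0 ?cmod_sqr_lt1.
  apply: usum_has_sum; rewrite (funext g1E); apply: has_sumZ.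
  exact: (has_sum_reindex (@opprK _) (@opprK _) (abs_summable_has_sum sT')).
have hD := has_sumB (has_sum_delta_r (0 : int) sg0) (has_sum_delta_l (1 : int) sg1).
rewrite mulrBr mulr1 [S * _]mulrC -ug0 -[RHS]subr0 -ug1.
apply: has_sum_unique hS' _; move: hD; congr has_sum; apply/funext => -[N j];
rewrite /F /sh /= [_ * (gate _ _ * _)]mulrCA strip_step// -mulrBl.
have gate_diff : gate N j - gate (N - 1) (j - 1) = delta R (0 : int) j - delta R (1 : int) N.
  rewrite /gate /delta.
  have -> : (0 <= j - 1) = (1 <= j) by lia.
  have -> : (1 <= N - 1) = (2 <= N) by lia.
  have -> : (0 <= j)%R%:R = (j == 0)%:R + (1 <= j)%R%:R :> C.
    by case: (eqVneq j 0) => [->|j0] /=; rewrite ?addr0 ?add0r//; congr (_%:R); lia.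
  have -> : (1 <= N)%R%:R = (N == 1)%:R + (2 <= N)%R%:R :> C.
    by case: (eqVneq N 1) => [->|N0] /=; rewrite ?addr0 ?add0r//; congr (_%:R); lia.
  by ring.
rewrite gate_diff mulrBl /delta /g0 /g1.
by congr (_ - _); [case: eqP => [->|]|case: eqP => [->|]];
  rewrite ?mulr1 ?mul1r ?mulr0 ?mul0r.
Qed.

End FourfoldSum.

(** * The recurrence in j and the main identity *)

Section HeckeRecurrence.
Variables (R : realType) (q : R[i]) (t m : int).
Hypotheses (q0 : q != 0) (q1 : cmod q < 1) (t1 : 1 <= t).
Local Notation C := R[i].

(** The even exponent makes the first argument a power of [q^2], the base of the theta series
    produced by a shift in [s]; hence that series vanishes. *)
Definition hecke_pw (p w : int) : C := hecke 2 (2 * t) 1 (q ^ (2 * p)) (q ^ w) q.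

Let t2 : 0 <= 2 * t. Proof. by lia. Qed.

Lemma hecke_pw_s p w : hecke_pw p w = - q ^ w * hecke_pw (p + t) (w + 1).
Proof.
rewrite /hecke_pw (hecke_shift q0 q1) ?expfz_neq0//.
rewrite -(exprz_exp q 2 p) (usum_theta_term_expz (sqr_neq0 q0) (cmod_sqr_lt1 q1)) addr0.
by rewrite (exprz_exp q 2 p) -(expfzDr (2 * p) _ q0) -(expfzDr w _ q0) mulrDr.
Qed.

(** By [hecke_sym] a shift in [r] becomes a shift in the second index; its boundary theta series has
    base [q] and vanishes at [q^w]. *)
Lemma hecke_pw_r p w : hecke_pw p w = - q ^ (2 * p) * hecke_pw (p + 1) (w + 2 * t).
Proof.
rewrite /hecke_pw !(hecke_sym q0 q1 (isT : (1 : int) <= 2)) ?expfz_neq0//.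
rewrite (hecke_shift q0 q1) ?expfz_neq0//.
rewrite (usum_theta_term_expz q0 q1) addr0.
by rewrite -(expfzDr (2 * p) _ q0) -(expfzDr w _ q0) mulrDr.
Qed.

Lemma hecke_pw_iter p w (n : nat) :
  hecke_pw p w = (-1) ^ n%:Z * q ^ (w * n%:Z + binz2 n) * hecke_pw (p + t * n%:Z) (w + n%:Z).
Proof.
elim: n => [|n ->]; first by rewrite !mulr0 !addr0 /= !expr0z !mul1r.
rewrite hecke_pw_s !mulrA.
have -> : p + t * n%:Z + t = p + t * n.+1%:Z by rewrite -addn1 PoszD; ring.
have -> : w + n%:Z + 1 = w + n.+1%:Z by rewrite -addn1 PoszD; ring.
congr (_ * _).
have -> : (-1) ^ n.+1%:Z = - (-1) ^ n%:Z :> C by rewrite exprSz mulN1r.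
have -> : w * n.+1%:Z + binz2 n.+1 = (w * n%:Z + binz2 n) + (w + n%:Z).
  by have := binz2_double n; have := binz2_double n.+1; nia.
by rewrite [in RHS]expfzDr//; ring.
Qed.

Definition period := 2 * t ^+ 2 - 1.

(** From [p], [2 t] shifts in [s] reach [p + 2 t^2]; from [p + period], one shift in [r] reaches the
    same point. Both raise [w] by [2 t], so the two values are proportional. *)
Lemma hecke_pw_period p : hecke_pw (p + period) (2 * m) =
  - q ^ (2 * p + 2 * t ^+ 2 - 2 + t - 4 * t * m) * hecke_pw p (2 * m).
Proof.
have [n nE] : exists n : nat, 2 * t = n%:Z by exists (absz (2 * t)); lia.
rewrite (hecke_pw_iter p _ n) -nE signz_double mul1r hecke_pw_r.
rewrite [RHS]mulrA [X in _ = X * _]mulNr -(expfzDr _ _ q0).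
congr (- q ^ _ * hecke_pw _ _); rewrite /period; last by ring.
have := binz2_double (2 * t); rewrite nE; nia.
Qed.

Lemma hecke_pw_periodz p (u : int) : hecke_pw (p + period * u) (2 * m) =
  (-1) ^ u * q ^ ((2 * p + 2 * t ^+ 2 - 2 + t - 4 * t * m) * u + 2 * period * binz2 u) *
  hecke_pw p (2 * m).
Proof.
(* An equivalence, so that it serves both directions of the induction over the integers. *)
have step v : (hecke_pw (p + period * (v + 1)) (2 * m) =
    (-1) ^ (v + 1) * q ^ ((2 * p + 2 * t ^+ 2 - 2 + t - 4 * t * m) * (v + 1) +
      2 * period * binz2 (v + 1)) * hecke_pw p (2 * m)) <->
   (hecke_pw (p + period * v) (2 * m) =
    (-1) ^ v * q ^ ((2 * p + 2 * t ^+ 2 - 2 + t - 4 * t * m) * v +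
      2 * period * binz2 v) * hecke_pw p (2 * m)).
  rewrite mulrDr mulr1 addrA hecke_pw_period.
  have -> : binz2 (v + 1) = binz2 v + v.
    by have := binz2_double v; have := binz2_double (v + 1); nia.
  rewrite [v + 1]addrC signzS.
  set a := 2 * (p + _) + _ - _ + _ - _.
  set b := _ * v + 2 * period * binz2 v.
  rewrite (_ : _ * (1 + v) + _ = a + b); last by rewrite /a /b; ring.
  rewrite (expfzDr a b q0); move: (expfz_neq0 a q0).
  move: (hecke_pw _ _) (hecke_pw _ _) (q ^ a) (q ^ b) ((-1) ^ v) => h h0 qa qb sv qa0.
  split=> [e|->]; last by ring.
  by apply: (mulfI qa0); apply: oppr_inj; rewrite -mulNr e; ring.
elim/int_ind: u => [|n IH|n IH].
- by rewrite !mulr0 !addr0 /= !expr0z !mul1r.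
- by move/(proj2 (step _)): IH; rewrite -[n.+1]addn1 PoszD.
apply/(proj1 (step _)); rewrite (_ : - n.+1%:Z + 1 = - n%:Z)//.
by rewrite -addn1 PoszD; ring.
Qed.

End HeckeRecurrence.

Section MainIdentity.
Variables (R : realType) (q : R[i]) (t m : int).
Hypotheses (q0 : q != 0) (q1 : cmod q < 1) (t1 : 1 <= t).
Local Notation C := R[i].

Let Phi (j : int) : C := hecke_pw q t (t + 1 + j) (2 * m).
Let T (y : C) : C := usum predT (theta_term (q ^+ 2) y).

Let term (y : C) (N j : int) : C := y ^ N * theta_coef q (N - 1 - j) * Phi j.

(** For fixed [(N, j)] the coupling [q^(2 r j)] merges with [q^(2 (t + 1) r)] into the first
    argument of the Hecke sum [Phi j]. *)
Lemma usum_fourfold_col (y : C) (N j : int) : y != 0 ->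
  usum predT (fun p => fourfold q t m y (p, (N, j))) = gate R N j * term y N j.
Proof.
move=> y0; have a1 : (1 : int) <= 2 by [].
have b1 : 0 <= 2 * t by lia.
have c1 : (1 : int) <= 1 by [].
have := has_sumZ (gate R N j * (y ^ N * theta_coef q (N - 1 - j)))
  (abs_summable_has_sum (abs_summable_hecke q0 q1 a1 b1 c1
    (expfz_neq0 (2 * (t + 1 + j)) q0) (expfz_neq0 (2 * m) q0))).
rewrite -heckeE => h; rewrite /term mulrA; apply: usum_has_sum.
move: h; congr has_sum; apply/funext => -[r s].
rewrite /fourfold /hecke_term /knum /strip /= !(exprz_exp q).
set qA := q ^ (2 * (t + 1 + j) * r); set qB := q ^ (2 * m * s).
set qE := q ^ (2 * binz2 r + 2 * t * r * s + 1 * binz2 s).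
set qF := q ^ (_ + 2 * m * s); set qG := q ^ (2 * r * j).
have qFG : qF * qG = qA * qB * qE.
  rewrite /qA /qB /qE /qF /qG -!(expfzDr _ _ q0); congr (_ ^ _); ring.
move: (sg2 C r s) ((-1) ^ (r + s)) => c e.
rewrite (_ : _ * (c * _) = c * e * gate R N j * (y ^ N * theta_coef q (N - 1 - j)) *
  (qA * qB * qE)); last by ring.
by rewrite -qFG; ring.
Qed.

(** The sign is 1 and -1 on the two quadrants and 0 elsewhere; absolute convergence allows the
    restricted sums to be taken separately. *)
Lemma ktm_usum (x : C) : abs_summable (fun p => sg2 C p.1 p.2 * kterm t m x q p) ->
  ktm t m x q = usum predT (fun p => sg2 C p.1 p.2 * kterm t m x q p).
Proof.
move=> sk; rewrite /ktm.
rewrite (usum_mkcond [pred p : int * int | (0 <= p.1) && (0 <= p.2)]).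
rewrite (usum_mkcond [pred p : int * int | (p.1 < 0) && (p.2 < 0)]).
apply/esym/usum_has_sum.
set F1 := (X in usum _ X - _).
set F2 := (X in _ - usum _ X).
have dom (F : int * int -> C) : (forall p, F p = 0 \/
    (sg2 C p.1 p.2 * kterm t m x q p = F p \/ sg2 C p.1 p.2 * kterm t m x q p = - F p)) ->
    abs_summable F.
  move=> hF; apply: abs_summable_le sk => p.
  by case: (hF p) => [->|[->|->]]; rewrite ?cmod0 ?cmod_ge0 ?cmodN.
have h1 : has_sum F1 (usum predT F1).
  apply/abs_summable_has_sum/dom => p; rewrite /F1 inE; case: ifP => // h; last by left.
  right; left; case/andP: h => h1 h2.
  by rewrite sg2E h1 h2 /= addrK mul1r.
have h2 : has_sum F2 (usum predT F2).
  apply/abs_summable_has_sum/dom => p; rewrite /F2 inE; case: ifP => // h; last by left.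
  right; right; case/andP: h => h2 h3.
  by rewrite sg2E !leNgt h2 h3 /= !add0r mulN1r.
have := has_sumB h1 h2; congr has_sum; apply/funext => -[r s].
rewrite /F1 /F2 !inE sg2E /= !ltNge.
by case: (0 <= r); case: (0 <= s) => /=;
  rewrite ?addrK ?addr0 ?add0r ?subr0 ?sub0r ?subrr ?mul1r ?mul0r ?mulN1r ?oppr0.
Qed.

Lemma usum_ord (n : nat) (F : 'I_n -> C) : usum predT F = \sum_(k < n) F k.
Proof.
rewrite (usum_has_sum (has_sum_finite (A := [fset k in enum 'I_n]%fset) _)).
  by rewrite sum_fset_seq ?enum_uniq// big_enum.
by move=> i; rewrite inE mem_enum.
Qed.

Section Generic.
Variables (x : C).
Hypotheses (x0 : x != 0) (hx : forall n : int, x != q ^ (2 * n + 1)).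

Let y := q * x.

Let y0 : y != 0. Proof. by rewrite mulf_neq0. Qed.

Lemma generic_den (r : int) : 1 - x * q ^ (2 * r + 1) != 0.
Proof.
rewrite subr_eq0; apply/eqP => h; have /eqP := hx (- r - 1); apply.
have qr0 := expfz_neq0 (2 * r + 1) q0; apply: (mulIf qr0).
rewrite -h -(expfzDr _ _ q0) (_ : _ + _ = 0) ?expr0z//; ring.
Qed.

Lemma generic_yE (r : int) : y * q ^ (2 * r) = x * q ^ (2 * r + 1).
Proof. by rewrite /y (expfzDr (2 * r) 1 q0) expr1z; ring. Qed.

Lemma generic_Theta : T y = Theta y (q ^+ 2).
Proof. by rewrite (ThetaE (sqr_neq0 q0) (cmod_sqr_lt1 q1)). Qed.

Lemma generic_Theta_neq0 : Theta y (q ^+ 2) != 0.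
Proof.
have Q1 := cmod_sqr_lt1 q1.
have QX (k : nat) : (q ^+ 2) ^+ k = q ^ (2 * k%:Z) by rewrite -(exprz_exp q 2).
rewrite /Theta !mulf_neq0//; apply: qpoch_inf_neq0 => // k; rewrite QX.
- by rewrite generic_yE generic_den.
- rewrite subr_eq0; apply/eqP => h; have /eqP := hx k%:Z; apply.
  have h2 : q * x = q ^ 2 * q ^ (2 * k%:Z).
    by rewrite -[LHS]mul1r {1}h mulrAC divfK.
  apply: (mulfI q0); rewrite h2 -(expfzDr _ _ q0) (_ : 2 + _ = 1 + (2 * k%:Z + 1)); last by ring.
  by rewrite (expfzDr 1 _ q0) expr1z.
rewrite -[q ^+ 2]/(q ^ 2) -(expfzDr _ _ q0) subr_eq0; apply/eqP => h.
have : cmod (q ^ (2 + 2 * k%:Z)) < 1.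
  rewrite (_ : 2 + 2 * k%:Z = (k.+1.*2)%N%:Z); last by lia.
  by rewrite -exprnP cmodX exprn_ilt1 ?cmod_ge0.
by rewrite -h cmod1 ltxx.
Qed.

Lemma abs_summable_col : abs_summable (fun p => gate R p.1 p.2 * term y p.1 p.2).
Proof.
pose sw (p : (int * int) * (int * int)) := (p.2, p.1).
have swK : cancel sw sw by case.
have := abs_summable_rows (abs_summable_reindex swK (abs_summable_fourfold m q0 q1 t1 y0)).
congr abs_summable; apply/funext => -[N j]; exact: usum_fourfold_col.
Qed.

(** The fourfold sum in two orders: rows [(r, s)] give the left side by [usum_strip], columns
    [(N, j)] the right side. *)
Lemma ktm_laurent :
  y * T y * ktm t m x q = usum predT (fun p => gate R p.1 p.2 * term y p.1 p.2).
Proof.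
have sF := abs_summable_fourfold m q0 q1 t1 y0.
have T0 : T y != 0 by rewrite generic_Theta generic_Theta_neq0.
have rowE (p : int * int) : usum predT (fun p' => fourfold q t m y (p, p')) =
    y * T y * (sg2 C p.1 p.2 * kterm t m x q p).
  case: p => r s; have := generic_den r; rewrite -generic_yE => d0.
  have sS := abs_summable_strip m q0 q1 t1 r y0.
  have := has_sumZ (sg2 C r s * knum q t m r s) (abs_summable_has_sum sS).
  rewrite (usum_strip m q0 q1 t1 y0 d0) => /usum_has_sum ->.
  rewrite /kterm -generic_yE /= -/(T y) -/(knum q t m r s); ring.
have hr := has_sum_rows sF; have sr := abs_summable_rows sF.
rewrite (funext rowE) in hr sr.
(* Summability of the series for [k_{t,m}] itself is read off from the rows, after division by the
   nonzero [y T(y)]. *)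
have sk : abs_summable (fun p => sg2 C p.1 p.2 * kterm t m x q p).
  have := abs_summableZ (y * T y)^-1 sr; congr abs_summable; apply/funext => p.
  by rewrite mulKf// mulf_neq0.
rewrite (ktm_usum sk).
rewrite (has_sum_unique (has_sumZ (y * T y) (abs_summable_has_sum sk)) hr).
apply/esym/usum_has_sum; have := has_sum_cols sF.
by congr has_sum; apply/funext => -[N j]; exact: usum_fourfold_col.
Qed.

Let D := period t.
Let c := 2 * t ^+ 2 * D.
Let xk (k : int) : C := x^-1 * q ^ (2 * k + 1).
Let yk (k : int) : C := - q ^ (4 * t ^+ 2 * k - 2 + 3 * t - 4 * t * m + 4 * t ^+ 4).

Lemma period_ge1 : 1 <= D.
Proof. by rewrite /D /period expr2; nia. Qed.

(** The theta coefficient contributes [D^2 u^2] to the exponent and the period relation [D u^2]; as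
    [D + 1 = 2 t^2], their sum is [c u^2], which explains the third parameter of the Hecke sum in
    base [q^2]. *)
Lemma term_period (k r u : int) :
  term y (- r) (k - 1 + D * u) =
  (-1) ^ k * q ^ (k * (k + 1)) * Phi (k - 1) *
  hecke_term (q ^+ 2) 1 D c (xk k) (yk k) (r, u).
Proof.
rewrite /term /Phi (_ : t + 1 + _ = t + k + D * u); last by ring.
rewrite (hecke_pw_periodz _ q0 q1 t1) (_ : t + 1 + (k - 1) = t + k); last by ring.
rewrite /hecke_term /theta_coef /=.
set n := - r - 1 - (k - 1 + D * u).
set A := (2 * (t + k) + _ - _ + _ - _) * u + _.
set E := 1 * binz2 r + _ + _.
have e1 : y ^ (- r) = q ^ (- r) * x ^ (- r) by rewrite /y expfzMl.
have e2 : xk k ^ r = x ^ (- r) * q ^ ((2 * k + 1) * r).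
  by rewrite /xk expfzMl exprz_inv (exprz_exp q).
have e3 : yk k ^ u = (-1) ^ u *
    q ^ ((4 * t ^+ 2 * k - 2 + 3 * t - 4 * t * m + 4 * t ^+ 4) * u).
  by rewrite /yk expNrz (exprz_exp q).
set F := (4 * t ^+ 2 * k - _ + _ - _ + _) * u in e3.
have e4 : (-1) ^ n = (-1) ^ k * (-1) ^ (r + u) :> C.
  rewrite -signzD; apply: (@signz_parity _ _ _ (- (r + k) - t ^+ 2 * u)).
  by rewrite /n /D /period; ring.
have e5 : (q ^+ 2) ^ E = q ^ (2 * E) by rewrite (exprz_exp q 2).
have qE : q ^ (- r) * q ^ (n * (n - 1)) * q ^ A =
    q ^ (k * (k + 1)) * q ^ ((2 * k + 1) * r) * q ^ F * q ^ (2 * E).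
  rewrite -!(expfzDr _ _ q0); congr (q ^ _); apply/eqP; rewrite -subr_eq0; apply/eqP.
  (* The exponents agree only modulo [2 * binz2 n = n * (n - 1)], so their difference is written as
     a combination of two instances of that relation. *)
  rewrite (_ : _ - _ = (D - c) * (2 * binz2 u - u * (u - 1)) -
    (2 * binz2 r - r * (r - 1))); last by rewrite /A /F /E /n /c /D /period; ring.
  by rewrite !binz2_double !subrr mulr0.
rewrite e1 e2 e3 e4 e5; move: qE.
move: (q ^ (- r)) (q ^ (n * (n - 1))) (q ^ A) (q ^ (k * (k + 1))) (q ^ ((2 * k + 1) * r))
  (q ^ F) (q ^ (2 * E)) (hecke_pw _ _ _ _) ((-1) ^ u) => q1' q2' q3 q4 q5 q6 q7 h su qE.
rewrite (_ : _ * _ * _ = x ^ (- r) * (-1) ^ k * (-1) ^ (r + u) * su * h *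
  (q1' * q2' * q3)); last by ring.
by rewrite qE; ring.
Qed.

(** One period down, since the first argument in the theorem is [q^(2 (t + k - D))]. *)
Lemma Phi_reduce (k : int) : Phi (k - 1) =
  - q ^ (2 * k + 3 * t - 2 * t ^+ 2 - 4 * t * m) *
  hecke 2 (2 * t) 1 (q ^ (2 * t + 2 - 4 * t ^+ 2 + 2 * k)) (q ^ (2 * m)) q.
Proof.
rewrite /Phi (_ : t + 1 + _ = (t + k - D) + D); last by ring.
rewrite (hecke_pw_period _ q0 q1 t1) /hecke_pw.
by congr (- q ^ _ * hecke _ _ _ (q ^ _) _ _); rewrite /D /period; ring.
Qed.

(** With [j = k - 1 + D u] and [0 <= k < D], the condition [u >= 0] means [j >= -1], whereas [gate]
    asks for [j >= 0]. Adding the line [j = -1], whose sum is [Phi (- 1) * T y], therefore turns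
    [gate] into the sign of a Hecke sum in [(r, u)] with [r = - N]. *)
Lemma gate_term_usum :
  usum predT (fun p => gate R p.1 p.2 * term y p.1 p.2) =
  - Phi (- 1) * T y + \sum_(0 <= k < absz D) (-1) ^ k%:Z * q ^ (k%:Z * (k%:Z + 1)) *
    Phi (k%:Z - 1) * hecke 1 D c (xk k) (yk k) (q ^+ 2).
Proof.
have Q0 := sqr_neq0 q0; have Q1 := cmod_sqr_lt1 q1.
have sT := abs_summable_theta Q0 Q1 y0.
pose g1 (N : int) := term y N (- 1).
have g1E N : g1 N = Phi (- 1) * theta_term (q ^+ 2) y N.
  by rewrite /g1 /term theta_termE (_ : N - 1 - - 1 = N); [ring|ring].
have sg1 : abs_summable g1 by rewrite (funext g1E); exact: abs_summableZ.
have ug1 : usum predT g1 = Phi (- 1) * T y.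
  apply: usum_has_sum; rewrite (funext g1E).
  exact: has_sumZ (abs_summable_has_sum sT).
have hS := has_sumD (abs_summable_has_sum abs_summable_col) (has_sum_delta_r (- 1 : int) sg1).
have sS := abs_summableD abs_summable_col (abs_summableM sg1 (abs_summable_delta R (- 1 : int))).
rewrite ug1 in hS.
have [n Dn] : exists n : nat, D = n.+1%:Z.
  by exists (absz D).-1; have := period_ge1; lia.
(* [k] and [u] are the remainder and the quotient of [j + 1] by [D]. *)
pose h (p : 'I_n.+1 * (int * int)) : int * int := (- p.2.1, p.1%:Z - 1 + D * p.2.2).
pose g (p : int * int) : 'I_n.+1 * (int * int) :=
  (inord (absz ((p.2 + 1) %% D)%Z), (- p.1, ((p.2 + 1) %/ D)%Z)).
have D0 : D != 0 by have := period_ge1; lia.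
have hK : cancel h g.
  move=> [k [r u]]; rewrite /h /g /= opprK.
  rewrite (_ : k%:Z - 1 + D * u + 1 = u * D + k%:Z); last by ring.
  have kD : 0 <= k%:Z < `|D| by rewrite Dn; have := ltn_ord k; lia.
  rewrite divzMDl// modzMDl divz_small// addr0 modz_small; first by rewrite absz_nat inord_val.
  by rewrite Dn; have := ltn_ord k; lia.
have gK : cancel g h.
  move=> [N j]; rewrite /h /g /= opprK; congr (_, _).
  have m0 := modz_ge0 (j + 1) D0.
  have m1 : ((j + 1) %% D)%Z < n.+1%:Z by rewrite -Dn; apply: ltz_pmod; rewrite Dn.
  rewrite inordK; last by lia.
  have := divz_eq (j + 1) D; move: m0 m1; set a := ((j + 1) %% D)%Z.
  by set b := ((j + 1) %/ D)%Z => a0 a1; nia.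
have termE (k : 'I_n.+1) (r u : int) :
    gate R (- r) (k%:Z - 1 + D * u) * term y (- r) (k%:Z - 1 + D * u) +
    g1 (- r) * delta R (- 1 : int) (k%:Z - 1 + D * u) =
    (-1) ^ k%:Z * q ^ (k%:Z * (k%:Z + 1)) * Phi (k%:Z - 1) *
    (sg2 C r u * hecke_term (q ^+ 2) 1 D c (xk k) (yk k) (r, u)).
  have kn := ltn_ord k.
  transitivity (sg2 C r u * term y (- r) (k%:Z - 1 + D * u)); last first.
    by rewrite (term_period k%:Z r u) mulrCA.
  have -> : sg2 C r u = gate R (- r) (k%:Z - 1 + D * u) + delta R (- 1 : int) (k%:Z - 1 + D * u).
    rewrite sg2E /gate /delta.
    have -> : (1 <= - r) = ~~ (0 <= r) by lia.
    have -> : (0 <= k%:Z - 1 + D * u) = (0 <= u) && (k%:Z - 1 + D * u != - 1).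
      by rewrite Dn; nia.
    have : k%:Z - 1 + D * u == - 1 -> 0 <= u by rewrite Dn; nia.
    case: (k%:Z - 1 + D * u == - 1) => [->//|_]; case: (0 <= r); case: (0 <= u) => //=; ring.
  rewrite [RHS]mulrDl; congr (_ + _); rewrite [LHS]mulrC /delta; case: eqP => [->//|_].
  by rewrite mulr0n [LHS]mul0r [RHS]mul0r.
have hR := has_sum_reindex hK gK hS; have sR := abs_summable_reindex hK sS.
have hrow := has_sum_rows sR.
rewrite (usum_has_sum hR) in hrow.
have rowE (k : 'I_n.+1) : usum predT (fun p => (fun i => gate R (h i).1 (h i).2 *
     term y (h i).1 (h i).2 + g1 (h i).1 * delta R (- 1 : int) (h i).2) (k, p)) =
   (-1) ^ k%:Z * q ^ (k%:Z * (k%:Z + 1)) * Phi (k%:Z - 1) * hecke 1 D c (xk k) (yk k) (q ^+ 2).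
  apply: usum_has_sum; rewrite heckeE.
  have xk0 : xk k != 0 by rewrite mulf_neq0 ?invr_eq0 ?expfz_neq0.
  have yk0 : yk k != 0 by rewrite oppr_eq0 expfz_neq0.
  have D1 := period_ge1.
  have c1 : 1 <= c by rewrite /c expr2; nia.
  have := has_sumZ ((-1) ^ k%:Z * q ^ (k%:Z * (k%:Z + 1)) * Phi (k%:Z - 1))
    (abs_summable_has_sum (abs_summable_hecke Q0 Q1 (lexx 1) (le_trans ler01 D1) c1 xk0 yk0)).
  by congr has_sum; apply/funext => -[r u]; rewrite /h /= termE.
have := usum_has_sum hrow; rewrite usum_ord; under eq_bigr do rewrite rowE.
move=> e; apply: (addIr (Phi (- 1) * T y)); rewrite -e Dn big_mkord; ring.
Qed.

(** Division by the theta value leaves the constant [- Phi (- 1)], which does not involve [x] and so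
    can be eliminated between two values of [x]. *)
Lemma ktm_hecke :
  y * ktm t m x q = - Phi (- 1) - q ^ (- 2 * t ^+ 2 + 3 * t - 4 * t * m) *
  \sum_(0 <= k < absz D)
    ((-1) ^+ k * q ^+ (k ^ 2 + 3 * k)%N *
     hecke 2 (2 * t) 1 (q ^ (2 * t + 2 - 4 * t ^+ 2 + 2 * k%:Z)) (q ^ (2 * m)) q *
     ((Theta y (q ^+ 2))^-1 * hecke 1 D c (xk k) (yk k) (q ^+ 2))).
Proof.
have T0 := generic_Theta_neq0; have := ktm_laurent; rewrite generic_Theta.
rewrite gate_term_usum generic_Theta => e.
apply: (mulIf T0); rewrite mulrAC e mulrBl; congr (_ + _).
rewrite [X in _ = - X]mulrAC mulr_sumr -sumrN; apply: eq_bigr => k _.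
rewrite Phi_reduce.
move: (hecke 2 _ _ _ _ _) (hecke 1 _ _ _ _ _) => h1 h2.
have -> : q ^+ (k ^ 2 + 3 * k)%N = q ^ (k%:Z ^+ 2 + 3 * k%:Z).
  by rewrite exprnP; congr (q ^ _); rewrite PoszD PoszM -mulnn PoszM expr2.
have qE : q ^ (k%:Z * (k%:Z + 1)) * q ^ (2 * k%:Z + 3 * t - 2 * t ^+ 2 - 4 * t * m) =
    q ^ (- 2 * t ^+ 2 + 3 * t - 4 * t * m) * q ^ (k%:Z ^+ 2 + 3 * k%:Z).
  by rewrite -!(expfzDr _ _ q0); congr (q ^ _); ring.
rewrite (_ : _ * _ * h2 = - ((-1) ^ k%:Z * h1 * h2 *
  (q ^ (k%:Z * (k%:Z + 1)) * q ^ (2 * k%:Z + 3 * t - 2 * t ^+ 2 - 4 * t * m)))); last by ring.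
rewrite qE -[(-1) ^ k%:Z]/((-1) ^+ k); congr (- _).
by field.
Qed.

End Generic.
End MainIdentity.

Theorem theorem1p3 (R : realType) (q x : R[i]) (t m : int)
    (hq0 : q != 0) (hq1 : `|q| < 1) (ht : 1 <= t)
    (hx0 : x != 0) (hx1 : x != -1)
    (hx : forall n : int, x != q ^ (2 * n + 1)) :
  Vtm t m x q =
    q ^ (- 2 * t ^+ 2 + 3 * t - 4 * t * m) /
      ((1 + x) * qpoch_inf q q * qpoch_inf (q ^+ 2) (q ^+ 2)) *
    \sum_(0 <= k < absz (2 * t ^+ 2 - 1)%R)
      ((-1) ^+ k * q ^+ (k ^ 2 + 3 * k)%N *
       hecke 2 (2 * t) 1
         (q ^ (2 * t + 2 - 4 * t ^+ 2 + 2 * k%:Z)) (q ^ (2 * m)) q *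
       ((Theta (- q) (q ^+ 2))^-1 *
          hecke 1 (2 * t ^+ 2 - 1) (2 * t ^+ 2 * (2 * t ^+ 2 - 1))
            (- q ^ (2 * k%:Z + 1))
            (- q ^ (4 * t ^+ 2 * k%:Z - 2 + 3 * t - 4 * t * m + 4 * t ^+ 4))
            (q ^+ 2)
        - (Theta (q * x) (q ^+ 2))^-1 *
          hecke 1 (2 * t ^+ 2 - 1) (2 * t ^+ 2 * (2 * t ^+ 2 - 1))
            (x^-1 * q ^ (2 * k%:Z + 1))
            (- q ^ (4 * t ^+ 2 * k%:Z - 2 + 3 * t - 4 * t * m + 4 * t ^+ 4))
            (q ^+ 2))).
Proof.
have q1 : cmod q < 1 by move: hq1; rewrite normcC -[1]/(1%:C%C) ltcR.
(* The value -1 is itself generic: an odd power of [q] never has modulus 1. *)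
have hN (n : int) : -1 != q ^ (2 * n + 1).
  apply/eqP => h; have cq : cmod q ^ (2 * n + 1) = 1 by rewrite -cmodXz -h cmodN cmod1.
  have cq0 : 0 < cmod q by rewrite cmod_gt0.
  move: cq; have [n0|n0] := lerP 0 n.
    rewrite (_ : 2 * n + 1 = (absz (2 * n + 1))%:Z) -?exprnP; last by lia.
    by move=> e; have := exprn_ilt1 (absz (2 * n + 1)) (ltW cq0) q1; rewrite e ltxx; lia.
  rewrite (_ : 2 * n + 1 = - (absz (2 * n + 1))%:Z) -?exprnN; last by lia.
  move/(congr1 GRing.inv); rewrite invrK invr1 => e.
  by have := exprn_ilt1 (absz (2 * n + 1)) (ltW cq0) q1; rewrite e ltxx; lia.
have kx := ktm_hecke m hq0 q1 ht hx0 hx.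
have kN := ktm_hecke m hq0 q1 ht (N1_neq0 R) hN.
(* Here [a] and [b] stand for [k_{t,m}] at [-1] and at [x], and [F] for the shared constant. Since
   [x q x^-1 a = - (q * -1 * a)], the two copies of [F] cancel. *)
have combine (a b F S1 S2 P1 P2 pref : R[i]) :
    q * -1 * a = - F - pref * S1 -> q * x * b = - F - pref * S2 ->
    (P1 * P2)^-1 * (x * q / (1 + x) * (x^-1 * a + b)) =
    pref / ((1 + x) * P1 * P2) * (S1 - S2).
  move=> ha hb; have e : x * q * (x^-1 * a + b) = pref * (S1 - S2).
    rewrite mulrDr (_ : x * q * (x^-1 * a) = - (q * -1 * a)); last by field.
    by rewrite ha [x * q]mulrC hb; ring.
  rewrite [X in _ * X = _]mulrAC e !invfM.
  by move: (1 + x)^-1 P1^-1 P2^-1 => z1 z2 z3; ring.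
have sumBr (n : nat) (a b d : nat -> R[i]) : \sum_(0 <= k < n) a k * (b k - d k) =
    \sum_(0 <= k < n) a k * b k - \sum_(0 <= k < n) a k * d k.
  by rewrite -sumrB; apply: eq_bigr => k _; rewrite mulrBr.
rewrite sumBr /Vtm /kbar.
apply: combine; last exact: kx.
apply: (etrans kN); apply: (congr1 (fun S => - _ - _ * S)).
apply: eq_bigr => k _; apply: (congr1 (fun S => _ * S)).
(* At [x = -1] the theta argument [q x] is [- q] and the factor [x^-1] is [-1]. *)
rewrite mulrN1.
by rewrite invrN1 mulN1r.
Qed.
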